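(* Let $\lambda$ be a partition of $k$ and $\mathcal{T}$ a standard tableau of shape $\lambda$, and let $\sigma_i$ be the $(v,v^{-1})$-content of the cell of $\mathcal{T}$ occupied by $i$. Then the primitive orthogonal idempotent $E^\lambda_{\mathcal{T}}$ of $H_k(v,t)$ is obtained by the consecutive evaluations $$E^\lambda_{\mathcal{T}}=f(\lambda)\,\Psi(u_1,\dots,u_k)\big|_{u_1=\sigma_1}\big|_{u_2=\sigma_2}\cdots\big|_{u_k=\sigma_k}.$$
   Context: $v,t$ are formal variables. $H_k(v,t)$ is the unital associative $\mathbb{Q}(v,t)$-algebra with generators $T_i$, $1\le i<k$, and relations: $T_iT_{i+1}T_i=T_{i+1}T_iT_{i+1}$ for $1\le i<k-1$; $T_iT_j=T_jT_i$ if $|i-j|\ge2$; $(T_i-v^{-1}t)(T_i+vt)=0$ for $1\le i<k$. $H_{k-1}(v,t)$ is regarded as the subalgebra generated by $T_1,\dots,T_{k-2}$. Jucys–Murphy elements: $y_1=1$, $y_{i+1}=t^{-2}T_iy_iT_i$ for $1\le i\le k-1$. Partitions are identified with Young diagrams (left-justified rows of cells). A cell in row $m$ and column $n$ has $(v,v^{-1})$-content $v^{-2(n-m)}$. A cell outside $\mu$ is addable to $\mu$ if its union with $\mu$ is a Young diagram. A standard tableau of shape $\lambda$ is a bijective filling of the cells with $1,\dots,k$ increasing along rows and down columns. The elements $E^\lambda_{\mathcal{T}}$ are defined inductively: for $k=1$, $E^\lambda_{\mathcal{T}}=1$; for $k\ge2$, $$E^\lambda_{\mathcal{T}}=E^\mu_{\mathcal{U}}\,\frac{(y_k-\rho_1)\cdots(y_k-\rho_l)}{(\sigma-\rho_1)\cdots(\sigma-\rho_l)},$$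 where $\mathcal{U}$, of shape $\mu$, is obtained from $\mathcal{T}$ by removing the cell $\alpha$ occupied by $k$, $\rho_1,\dots,\rho_l$ are the $(v,v^{-1})$-contents of all addable cells of $\mu$ except $\alpha$, and $\sigma$ is the $(v,v^{-1})$-content of $\alpha$. They form a family of primitive orthogonal idempotents of $H_k(v,t)$. For $\lambda=(\lambda_1,\dots,\lambda_l)$ with conjugate $\lambda'$, the hook of $\alpha=(i,j)\in\lambda$ is $h_\alpha=\lambda_i+\lambda'_j-i-j+1$, and $$f(\lambda)=v^{-b(\lambda)}t^{\frac{k(k-1)}{2}}(1-v^{-2})^k\prod_{\alpha\in\lambda}(1-v^{-2h_\alpha})^{-1},\qquad b(\lambda)=\sum_{i\ge1}\lambda_i(\lambda_i-1).$$ $T_i(x,y)=t^{-1}T_i+\frac{(v^{-1}-v)x}{y-x}$, a rational function of $x,y$ with values in $H_k(v,t)$. $T_{w_k}=T_1(T_2T_1)\cdots(T_{k-1}T_{k-2}\cdots T_1)$ is the basis element of the longest element of the symmetric group on $k$ letters ($T_{w_1}=1$). Finally $$\Psi(u_1,\dots,u_k)=\Big(\prod_{i=1,\dots,k-1}^{\longrightarrow}\big(T_i(u_1,u_{i+1})T_{i-1}(u_2,u_{i+1})\cdots T_1(u_i,u_{i+1})\big)\Big)\cdot T_{w_k}^{-1},$$ with the ordered product taken from left to right in the order $i=1,\dots,k-1$. The evaluations are carried out successively: first $u_1=\sigma_1$, then $u_2=\sigma_2$, and so on; the assertion includes that each successive evaluation is well defined. *)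

(* Defs.v *)
From HB Require Import structures.
From mathcomp Require Import all_boot all_order all_algebra generic_quotient.
From mathcomp Require Import fraction mpoly.
From mathcomp Require Import boolp.

Set Implicit Arguments.
Unset Strict Implicit.
Unset Printing Implicit Defensive.

Import GRing.Theory.
Local Open Scope ring_scope.
Local Open Scope quotient_scope.

(* T i stands for the generator with index i + 1, where i : 'I_k.-1. *)
Record hecke_relations (F : fieldType) (v t : F) (k : nat) (B : algType F)
    (T : 'I_k.-1 -> B) : Prop := HeckeRelations {
  hecke_braid : forall i j : 'I_k.-1, j = i.+1 :> nat ->
    T i * T j * T i = T j * T i * T j;
  hecke_comm : forall i j : 'I_k.-1, (i.+2 <= j)%N || (j.+2 <= i)%N ->
    T i * T j = T j * T i;
  hecke_quad : forall i : 'I_k.-1,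
    (T i - (v^-1 * t)%:A) * (T i + (v * t)%:A) = 0 }.

(* The algebra presented by generators and relations is built as formal
   algebra expressions in the generators, two expressions being identified
   when they agree in every algebra satisfying the relations; see
   [hecke_gen_relations], [hecke_lift_gen] and [hecke_lift_unique] below for
   the universal property.                                                 *)
Inductive hterm (F : Type) (k : nat) : Type :=
| HGen of 'I_k.-1
| HConst of F
| HAdd of hterm F k & hterm F k
| HMul of hterm F k & hterm F k.
Arguments HGen {F k}.
Arguments HConst {F k}.

HB.instance Definition _ (F : Type) k := gen_eqMixin (hterm F k).
HB.instance Definition _ (F : Type) k := gen_choiceMixin (hterm F k).

Fixpoint hteval (F : fieldType) k (B : algType F) (T : 'I_k.-1 -> B)
    (x : hterm F k) : B :=
  match x with
  | HGen i => T i
  | HConst c => c%:A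
  | HAdd x y => hteval T x + hteval T y
  | HMul x y => hteval T x * hteval T y
  end.

Section HeckeConstruction.
Variables (F : fieldType) (v t : F) (k : nat).

Definition hcong (x y : hterm F k) : Prop :=
  forall (B : algType F) (T : 'I_k.-1 -> B), hecke_relations v t T ->
    hteval T x = hteval T y.

Definition hcongb x y := `[< hcong x y >].

Lemma hcongb_refl : reflexive hcongb.
Proof. by move=> x; apply/asboolP => B T _. Qed.

Lemma hcongb_sym : ssrbool.symmetric hcongb.
Proof.
by move=> x y; apply/asboolP/asboolP => xy B T r; rewrite (xy B T r).
Qed.

Lemma hcongb_trans : transitive hcongb.
Proof.
move=> y x z /asboolP xy /asboolP yz; apply/asboolP => B T r.
by rewrite (xy B T r) (yz B T r).
Qed.

Canonical hcong_equiv := EquivRel hcongb hcongb_refl hcongb_sym hcongb_trans.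

Definition hecke := {eq_quot hcong_equiv}.

HB.instance Definition _ := EqQuotient.on hecke.
HB.instance Definition _ := Choice.on hecke.

Definition hpi (x : hterm F k) : hecke := \pi_hecke x.

Lemma hpi_eq x y : hcong x y <-> hpi x = hpi y.
Proof.
split; first by move=> xy; apply/eqmodP/asboolP.
by move/eqmodP/asboolP.
Qed.

Lemma hpi_repr (x : hecke) : hpi (repr x) = x.
Proof. by rewrite /hpi reprK. Qed.

Lemma hecke_ind (P : hecke -> Prop) : (forall x, P (hpi x)) -> forall x, P x.
Proof. by move=> Px x; rewrite -(hpi_repr x). Qed.

Lemma hrepr_eval x (B : algType F) (T : 'I_k.-1 -> B) : hecke_relations v t T ->
  hteval T (repr (hpi x)) = hteval T x.
Proof. by move=> r; have /hpi_eq := hpi_repr (hpi x); apply. Qed.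

Definition hadd (x y : hecke) := hpi (HAdd (repr x) (repr y)).
Definition hmul (x y : hecke) := hpi (HMul (repr x) (repr y)).
Definition hscale (c : F) (x : hecke) := hpi (HMul (HConst c) (repr x)).
Definition hopp (x : hecke) := hscale (-1) x.

Lemma haddE x y : hadd (hpi x) (hpi y) = hpi (HAdd x y).
Proof. by apply/hpi_eq => B T r /=; rewrite !hrepr_eval. Qed.
Lemma hmulE x y : hmul (hpi x) (hpi y) = hpi (HMul x y).
Proof. by apply/hpi_eq => B T r /=; rewrite !hrepr_eval. Qed.
Lemma hscaleE c x : hscale c (hpi x) = hpi (HMul (HConst c) x).
Proof. by apply/hpi_eq => B T r /=; rewrite !hrepr_eval. Qed.

Local Notation zero := (hpi (HConst 0)).
Local Notation one := (hpi (HConst 1)).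

Lemma haddA : associative hadd.
Proof.
elim/hecke_ind=> x; elim/hecke_ind=> y; elim/hecke_ind=> z.
by rewrite !haddE; apply/hpi_eq => B T _ /=; rewrite addrA.
Qed.
Lemma haddC : commutative hadd.
Proof.
elim/hecke_ind=> x; elim/hecke_ind=> y.
by rewrite !haddE; apply/hpi_eq => B T _ /=; rewrite addrC.
Qed.
Lemma hadd0 : left_id zero hadd.
Proof.
elim/hecke_ind=> x.
by rewrite !haddE; apply/hpi_eq => B T _ /=; rewrite scale0r add0r.
Qed.
Lemma haddN : left_inverse zero hopp hadd.
Proof.
elim/hecke_ind=> x; rewrite /hopp hscaleE haddE; apply/hpi_eq => B T _ /=.
by rewrite scaleN1r mulN1r addNr scale0r.
Qed.

HB.instance Definition _ := GRing.isZmodule.Build hecke haddA haddC hadd0 haddN.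

Lemma hpiD x y : hpi (HAdd x y) = hpi x + hpi y.
Proof. by rewrite -haddE. Qed.

Lemma hmulA : associative hmul.
Proof.
elim/hecke_ind=> x; elim/hecke_ind=> y; elim/hecke_ind=> z.
by rewrite !hmulE; apply/hpi_eq => B T _ /=; rewrite mulrA.
Qed.
Lemma hmul1 : left_id one hmul.
Proof.
elim/hecke_ind=> x.
by rewrite !hmulE; apply/hpi_eq => B T _ /=; rewrite scale1r mul1r.
Qed.
Lemma hmul1r : right_id one hmul.
Proof.
elim/hecke_ind=> x.
by rewrite !hmulE; apply/hpi_eq => B T _ /=; rewrite scale1r mulr1.
Qed.
Lemma hmulDl : left_distributive hmul hadd.
Proof.
elim/hecke_ind=> x; elim/hecke_ind=> y; elim/hecke_ind=> z.
by rewrite !(hmulE, haddE); apply/hpi_eq => B T _ /=; rewrite mulrDl.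
Qed.
Lemma hmulDr : right_distributive hmul hadd.
Proof.
elim/hecke_ind=> x; elim/hecke_ind=> y; elim/hecke_ind=> z.
by rewrite !(hmulE, haddE); apply/hpi_eq => B T _ /=; rewrite mulrDr.
Qed.

(* T_i |-> v^-1 t is a one-dimensional representation. *)
Lemma hecke1_neq0 : one != zero.
Proof.
apply/eqP => /hpi_eq /(_ F^o (fun=> v^-1 * t)).
have r : hecke_relations v t (fun _ : 'I_k.-1 => v^-1 * t : F^o).
  split=> // i.
  have -> : (v^-1 * t)%:A = (v^-1 * t : F^o) by exact: mulr1.
  by rewrite subrr mul0r.
move=> /(_ r) /= /eqP; rewrite scale1r scale0r; exact/negP/oner_neq0.
Qed.

HB.instance Definition _ := GRing.Zmodule_isNzRing.Build hecke
  hmulA hmul1 hmul1r hmulDl hmulDr hecke1_neq0.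

Lemma hpiM x y : hpi (HMul x y) = hpi x * hpi y.
Proof. by rewrite -hmulE. Qed.

Lemma hscaleA a b (x : hecke) : hscale a (hscale b x) = hscale (a * b) x.
Proof.
elim/hecke_ind: x => x; rewrite !hscaleE; apply/hpi_eq => B T _ /=.
by rewrite mulrA -scalerAl mul1r scalerA.
Qed.
Lemma hscale1 : left_id 1 hscale.
Proof.
elim/hecke_ind=> x; rewrite hscaleE; apply/hpi_eq => B T _ /=.
by rewrite scale1r mul1r.
Qed.
Lemma hscaleDr : right_distributive hscale +%R.
Proof.
move=> c; elim/hecke_ind=> x; elim/hecke_ind=> y.
by rewrite -hpiD !hscaleE -hpiD; apply/hpi_eq => B T _ /=; rewrite mulrDr.
Qed.
Lemma hscaleDl (x : hecke) : {morph hscale^~ x : a b / a + b}.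
Proof.
move=> a b; elim/hecke_ind: x => x.
by rewrite !hscaleE -hpiD; apply/hpi_eq => B T _ /=; rewrite scalerDl mulrDl.
Qed.

HB.instance Definition _ := GRing.Zmodule_isLmodule.Build F hecke
  hscaleA hscale1 hscaleDr hscaleDl.

Lemma hpiZ c x : hpi (HMul (HConst c) x) = c *: hpi x.
Proof. by rewrite -hscaleE. Qed.

Lemma hscaleAl (c : F) (x y : hecke) : c *: (x * y) = c *: x * y.
Proof.
elim/hecke_ind: x => x; elim/hecke_ind: y => y.
rewrite -!(hpiZ, hpiM); apply/hpi_eq => B T _ /=.
by rewrite mulrA.
Qed.

HB.instance Definition _ := GRing.Lmodule_isLalgebra.Build F hecke hscaleAl.

Lemma hscaleAr (c : F) (x y : hecke) : c *: (x * y) = x * (c *: y).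
Proof.
elim/hecke_ind: x => x; elim/hecke_ind: y => y.
rewrite -!(hpiZ, hpiM); apply/hpi_eq => B T _ /=.
by rewrite !mulr_algl scalerAr.
Qed.

HB.instance Definition _ := GRing.Lalgebra_isAlgebra.Build F hecke hscaleAr.

Definition hunit (x : hecke) : bool :=
  `[< exists y : hecke, y * x = 1 /\ x * y = 1 >].
Definition hinv (x : hecke) : hecke :=
  if pselect (exists y : hecke, y * x = 1 /\ x * y = 1) is left ex_y
  then sval (cid ex_y) else x.

Lemma hmulVr : {in hunit, left_inverse 1 hinv *%R}.
Proof.
move=> x /asboolP ux; rewrite /hinv.
by case: pselect => // ex_y; case: (svalP (cid ex_y)).
Qed.
Lemma hdivrr : {in hunit, right_inverse 1 hinv *%R}.
Proof.
move=> x /asboolP ux; rewrite /hinv.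
by case: pselect => // ex_y; case: (svalP (cid ex_y)).
Qed.
Lemma hunitrP x y : y * x = 1 /\ x * y = 1 -> hunit x.
Proof. by move=> xy; apply/asboolP; exists y. Qed.
Lemma hinv_out : {in [predC hunit], hinv =1 id}.
Proof. by move=> x /asboolPn nux; rewrite /hinv; case: pselect. Qed.

HB.instance Definition _ := GRing.NzRing_hasMulInverse.Build hecke
  hmulVr hdivrr hunitrP hinv_out.

Definition hecke_gen (i : 'I_k.-1) : hecke := hpi (HGen i).

Lemma hpi_const c : hpi (HConst c) = c%:A.
Proof.
rewrite -(hpiZ c (HConst 1)); apply/hpi_eq => B T _ /=.
by rewrite scale1r mulr1.
Qed.

Lemma hecke_gen_relations : hecke_relations v t hecke_gen.
Proof.
split.
- move=> i j ij; rewrite /hecke_gen -!hpiM.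
  by apply/hpi_eq => B T r /=; rewrite ?hrepr_eval // (hecke_braid r).
- move=> i j ij; rewrite /hecke_gen -!hpiM.
  by apply/hpi_eq => B T r /=; rewrite ?hrepr_eval // (hecke_comm r).
- move=> i; rewrite -scaleNr -!hpi_const /hecke_gen -!hpiD -hpiM.
  rewrite (_ : 0 = zero) //.
  apply/hpi_eq => B T r /=.
  by rewrite ?hrepr_eval //= scale0r scaleNr (hecke_quad r).
Qed.

Section UniversalProperty.
Variables (B : algType F) (T : 'I_k.-1 -> B) (r : hecke_relations v t T).

Definition hecke_lift (_ : hecke_relations v t T) (x : hecke) : B :=
  hteval T (repr x).

Lemma hecke_liftE x : hecke_lift r (hpi x) = hteval T x.
Proof. exact: hrepr_eval. Qed.

Lemma hecke_lift_linear : linear (hecke_lift r).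
Proof.
move=> c; elim/hecke_ind=> x; elim/hecke_ind=> y.
rewrite -hpiZ -hpiD !hecke_liftE /=.
by rewrite mulr_algl.
Qed.
HB.instance Definition _ :=
  GRing.isLinear.Build F hecke B *:%R (hecke_lift r) hecke_lift_linear.

Lemma hecke_lift_monoid : monoid_morphism (hecke_lift r).
Proof.
split; first by rewrite hecke_liftE /= scale1r.
elim/hecke_ind=> x; elim/hecke_ind=> y.
by rewrite -hpiM !hecke_liftE.
Qed.
HB.instance Definition _ :=
  GRing.isMonoidMorphism.Build hecke B (hecke_lift r) hecke_lift_monoid.

Lemma hecke_lift_gen i : hecke_lift r (hecke_gen i) = T i.
Proof. exact: hecke_liftE. Qed.

Lemma hecke_lift_unique (g : {lrmorphism hecke -> B}) :
  (forall i, g (hecke_gen i) = T i) -> g =1 hecke_lift r.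
Proof.
move=> gT; elim/hecke_ind=> x; rewrite hecke_liftE.
elim: x => [i|c|x IHx y IHy|x IHx y IHy] /=.
- exact: gT.
- by rewrite hpi_const linearZ rmorph1.
- by rewrite -IHx -IHy hpiD; exact: linearD.
- by rewrite -IHx -IHy hpiM; exact: rmorphM.
Qed.

End UniversalProperty.

End HeckeConstruction.

(* A rational function with values in A is a fraction N / d with N in
   A[u_1,...,u_n] and d in F[u_1,...,u_n]; fractions are compared by [rf_eq],
   for which a fraction with d = 0 is not equal to anything (not even to
   itself).                                                                *)
Record ratfun (F : fieldType) (A : algType F) (n : nat) := RatFun {
  rf_num : {mpoly A[n]};
  rf_den : {mpoly F[n]} }.

Section RationalFunctions.
Variables (F : fieldType) (A : algType F) (n : nat).
Implicit Types (phi psi : ratfun A n) (i : 'I_n) (s : F).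

Definition mplift (p : {mpoly F[n]}) : {mpoly A[n]} :=
  map_mpoly (in_alg A) p.

Definition rf_eq phi psi : Prop :=
  [/\ rf_den phi != 0, rf_den psi != 0
    & rf_num phi * mplift (rf_den psi) = rf_num psi * mplift (rf_den phi)].

Definition rf_cst (a : A) : ratfun A n := RatFun a%:MP 1.
Definition rf_frac (p q : {mpoly F[n]}) : ratfun A n := RatFun (mplift p) q.
Definition rf_scale (c : F) phi : ratfun A n :=
  RatFun (c%:A%:MP * rf_num phi) (rf_den phi).
Definition rf_add phi psi : ratfun A n :=
  RatFun (rf_num phi * mplift (rf_den psi) + rf_num psi * mplift (rf_den phi))
         (rf_den phi * rf_den psi).
Definition rf_mul phi psi : ratfun A n :=
  RatFun (rf_num phi * rf_num psi) (rf_den phi * rf_den psi).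

Definition psubst (R : nzRingType) (i : 'I_n) (r : R) (p : {mpoly R[n]}) :
    {mpoly R[n]} :=
  mmap (@mpolyC n R) (fun j => if j == i then r%:MP else 'X_j) p.

(* psi is the evaluation of phi at 'X_i = s, which is well defined when phi
   is a fraction whose denominator does not vanish identically on 'X_i = s. *)
Definition evaluates_to (i : 'I_n) (s : F) phi psi : Prop :=
  exists (N : {mpoly A[n]}) (d : {mpoly F[n]}),
    [/\ rf_eq phi (RatFun N d), psubst i s d != 0
      & rf_eq (RatFun (psubst i s%:A N) (psubst i s d)) psi].

(* psi is obtained from phi by successively evaluating u_1 at s 1, u_2 at
   s 2, ..., u_n at s n, where u_(i+1) is 'X_i for i : 'I_n.               *)
Definition consecutive_evaluation (s : nat -> F) phi psi : Prop :=
  exists chi : nat -> ratfun A n,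
    [/\ rf_eq phi (chi 0%N),
        forall i : 'I_n, evaluates_to i (s i.+1) (chi i) (chi i.+1)
      & rf_eq (chi n) psi].

(* Up to [rf_eq], evaluation is single-valued: see [evaluates_to_uniq] and
   [consecutive_evaluation_uniq].                                          *)
Lemma mpliftM p q : mplift (p * q) = mplift p * mplift q.
Proof. exact: rmorphM. Qed.

Lemma mplift_comm p (N : {mpoly A[n]}) : N * mplift p = mplift p * N.
Proof.
apply/mpolyP => m; rewrite mcoeffM mcoeffMr; apply: eq_bigr => x _.
by rewrite mcoeff_map_mpoly /= mulr_algl mulr_algr.
Qed.

Lemma mplift_reg p (N : {mpoly A[n]}) : p != 0 -> N * mplift p = 0 -> N = 0.
Proof.
move=> p0; apply: contraPeq => N0; apply/eqP.
have inj : injective (in_alg A) by exact: fmorph_inj.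
have pm : perm_eq (msupp (mplift p)) (msupp p) := msupp_map_mpoly p inj.
have p'0 : mplift p != 0.
  by rewrite -msupp_eq0 -size_eq0 (perm_size pm) size_eq0 msupp_eq0.
have lc : mleadc (mplift p) = (mleadc p)%:A.
  have -> : mlead (mplift p) = mlead p.
    apply/eqP; rewrite Order.POrderTheory.eq_le !msupp_le_mlead //.
      by rewrite (perm_mem pm) mlead_supp.
    by rewrite -(perm_mem pm) mlead_supp.
  by rewrite mcoeff_map_mpoly.
have lcN : mleadc N * mleadc (mplift p) != 0.
  by rewrite lc mulr_algr scaler_eq0 negb_or !mleadc_eq0 p0 N0.
by rewrite -mleadc_eq0 mleadcM_proper.
Qed.

Lemma mplift_regI p (M N : {mpoly A[n]}) :
  p != 0 -> M * mplift p = N * mplift p -> M = N.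
Proof.
move=> p0 /eqP; rewrite -subr_eq0 -mulrBl => /eqP /(mplift_reg p0) /eqP.
by rewrite subr_eq0 => /eqP.
Qed.

Lemma rf_eq_sym phi psi : rf_eq phi psi -> rf_eq psi phi.
Proof. by case=> d1 d2 e; split; [exact: d2 | exact: d1 | exact: esym e]. Qed.

Lemma cross_trans (R : nzRingType) (N1 N2 N3 D1 D2 D3 : R) :
  D2 * D3 = D3 * D2 -> D1 * D3 = D3 * D1 -> D1 * D2 = D2 * D1 ->
  N1 * D2 = N2 * D1 -> N2 * D3 = N3 * D2 -> N1 * D3 * D2 = N3 * D1 * D2.
Proof.
move=> c23 c13 c12 e12 e23; rewrite -mulrA -c23 mulrA e12 -mulrA c13.
by rewrite mulrA e23 -!mulrA c12.
Qed.

Lemma rf_eq_trans phi psi chi : rf_eq phi psi -> rf_eq psi chi -> rf_eq phi chi.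
Proof.
case=> [d1 d2 e12] [_ d3 e23]; split; [exact: d1 | exact: d3 |].
apply: (mplift_regI d2).
exact: (cross_trans (mplift_comm _ _) (mplift_comm _ _) (mplift_comm _ _)
  e12 e23).
Qed.

Lemma rf_eq_cst a b : rf_eq (rf_cst a) (rf_cst b) -> a = b.
Proof.
case=> _ _; rewrite /= /mplift rmorph1 !mulr1.
by move/(congr1 (mcoeff 0)); rewrite !mcoeffC eqxx !mulr1.
Qed.

Lemma psubst_lift i s p : psubst i s%:A (mplift p) = mplift (psubst i s p).
Proof.
have inj : injective (in_alg A) by exact: fmorph_inj.
have pm : perm_eq (msupp (mplift p)) (msupp p) := msupp_map_mpoly p inj.
have E (R : nzRingType) (r : R) (q : {mpoly R[n]}) : psubst i r q =
    \sum_(m <- msupp q) (q@_m)%:MP *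
       mmap1 (fun j => if j == i then r%:MP else 'X_j) m by [].
rewrite !E (perm_big _ pm) [RHS]raddf_sum; apply: eq_bigr => m _.
rewrite mcoeff_map_mpoly [RHS]mpliftM [mplift _%:MP]map_mpolyC; congr (_ * _).
rewrite /mplift.
rewrite /mmap1 rmorph_prod; apply: eq_bigr => j _; rewrite rmorphXn /=.
congr (_ ^+ _).
by case: ifP => _; rewrite ?map_mpolyC ?map_mpolyX.
Qed.

Lemma psubstM i s (M N : {mpoly A[n]}) :
  psubst i s%:A (M * N) = psubst i s%:A M * psubst i s%:A N.
Proof.
have ch (j : 'I_n) (x : {mpoly A[n]}) :
    GRing.comm x (if j == i then s%:A%:MP else 'X_j).
  case: ifP => _; last exact: commr_mpolyX.
  by have := mplift_comm s%:MP x; rewrite /mplift map_mpolyC.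
have [] := @commr_mmap_is_multiplicative n A {mpoly A[n]}
  (fun j => if j == i then s%:A%:MP else 'X_j) (@mpolyC n A) ch; last first.
  by move=> H _; exact: H.
move=> p m m'; rewrite /mmap1; apply: commr_prod => j _.
exact/commrX/ch.
Qed.

Lemma evaluates_to_uniq i s phi phi' psi psi' : rf_eq phi phi' ->
  evaluates_to i s phi psi -> evaluates_to i s phi' psi' -> rf_eq psi psi'.
Proof.
move=> e [N [d [e1 ds e2]]] [N' [d' [e1' ds' e2']]].
suff E : rf_eq (RatFun (psubst i s%:A N) (psubst i s d))
               (RatFun (psubst i s%:A N') (psubst i s d')).
  exact: rf_eq_trans (rf_eq_sym e2) (rf_eq_trans E e2').
have [_ _ /= E] := rf_eq_trans (rf_eq_sym e1) (rf_eq_trans e e1').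
split; [exact: ds | exact: ds' | rewrite /=].
have := congr1 (psubst i s%:A) E.
rewrite -!psubst_lift => E2.
exact: etrans (esym (psubstM _ _ _ _)) (etrans E2 (psubstM _ _ _ _)).
Qed.

Lemma consecutive_evaluation_uniq (s : nat -> F) phi psi psi' :
  consecutive_evaluation s phi psi -> consecutive_evaluation s phi psi' ->
  rf_eq psi psi'.
Proof.
move=> [chi [e0 ev en]] [chi' [e0' ev' en']].
apply: rf_eq_trans (rf_eq_sym en) (rf_eq_trans _ en').
have: (n <= n)%N by [].
elim: {1 3 4}n => [|m IH] mn; first exact: rf_eq_trans (rf_eq_sym e0) e0'.
have := evaluates_to_uniq (IH (ltnW mn)) (ev (Ordinal mn)) (ev' (Ordinal mn)).
exact.
Qed.

End RationalFunctions.

(* (m, n) is the cell in row m and column n, both counted from 1. *)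
Definition cell := (nat * nat)%type.

Definition is_partition (la : seq nat) : bool :=
  sorted geq la && (0%N \notin la).

Definition cells (la : seq nat) : seq cell :=
  [seq (m, n) | m <- iota 1 (size la), n <- iota 1 (nth 0%N la m.-1)].

(* Young diagrams are handled as finite sets of cells, listed in any order. *)
Definition young_diagram (D : seq cell) : Prop :=
  exists2 la, is_partition la & cells la =i D.

Definition addable (D : seq cell) (c : cell) : Prop :=
  c \notin D /\ young_diagram (c :: D).

(* The square of side [(size D).+1] contains all addable cells: see
   [mem_addable_cells].                                                    *)
Definition addable_cells (D : seq cell) : seq cell :=
  [seq c <- [seq (m, n) | m <- iota 1 (size D).+1, n <- iota 1 (size D).+1]
     | `[< addable D c >] ].

(* Only the values of T on the cells of la matter. *)
Definition standard_tableau (k : nat) (la : seq nat) (T : cell -> nat) : Prop :=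
  [/\ perm_eq (map T (cells la)) (iota 1 k),
      forall m n n', (m, n) \in cells la -> (m, n') \in cells la ->
        (n < n')%N -> (T (m, n) < T (m, n'))%N
    & forall m m' n, (m, n) \in cells la -> (m', n) \in cells la ->
        (m < m')%N -> (T (m, n) < T (m', n))%N].

(* The cell of D occupied by i in T. *)
Definition cell_of (T : cell -> nat) (D : seq cell) (i : nat) : cell :=
  nth (0%N, 0%N) D (index i (map T D)).

Definition conj_part (la : seq nat) (j : nat) : nat := count (leq j) la.

(* No truncation occurs in these subtractions when a is a cell of la. *)
Definition hook (la : seq nat) (a : cell) : nat :=
  nth 0%N la a.1.-1 + conj_part la a.2 - a.1 - a.2 + 1.

Lemma mem_cells la m n :
  ((m, n) \in cells la) =
  [&& (0 < m)%N, (m <= size la)%N, (0 < n)%N & (n <= nth 0%N la m.-1)%N].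
Proof.
rewrite /cells; apply/allpairsPdep/and4P.
  move=> [m' [n' [+ + [-> ->]]]]; rewrite !mem_iota !add1n !ltnS.
  by move=> /andP[-> ->] /andP[-> ->].
by case=> *; exists m, n; split=> //; rewrite mem_iota add1n ltnS; apply/andP.
Qed.

Lemma mem_addable_cells D c : c \in addable_cells D <-> addable D c.
Proof.
rewrite mem_filter; split=> [/andP[/asboolP] //|aD].
apply/andP; split; first exact/asboolP.
case: aD => _; case: c => m n [la /andP[_ la0] e].
have := e (m, n); rewrite mem_cells mem_head => /and4P[m0 ml n0 nl].
apply/allpairsPdep; exists m, n; rewrite !mem_iota !add1n !ltnS m0 n0 /=.
split=> //.
  have sub : {subset [seq (i, 1%N) | i <- iota 1 m] <= (m, n) :: D}.
    move=> _ /mapP[i + ->]; rewrite mem_iota add1n ltnS => /andP[i0 im].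
    rewrite -e mem_cells i0 (leq_trans im ml) /= lt0n.
    apply: contra la0 => /eqP <-; apply: mem_nth.
    by rewrite prednK // (leq_trans im ml).
  have := uniq_leq_size _ sub; rewrite size_map size_iota; apply.
  by rewrite map_inj_uniq ?iota_uniq // => ? ? [].
have sub : {subset [seq (m, i) | i <- iota 1 n] <= (m, n) :: D}.
  move=> _ /mapP[i + ->]; rewrite mem_iota add1n ltnS => /andP[i0 im].
  by rewrite -e mem_cells m0 ml i0 (leq_trans im nl).
have := uniq_leq_size _ sub; rewrite size_map size_iota; apply.
by rewrite map_inj_uniq ?iota_uniq // => ? ? [].
Qed.

Section Fusion.
Variables (F : fieldType) (v t : F).

Definition content (c : cell) : F := v ^ (- (2 * (c.2%:Z - c.1%:Z))).

Definition b_exp (la : seq nat) : nat := (\sum_(l <- la) l * (l - 1))%N.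

Definition fusion_factor (k : nat) (la : seq nat) : F :=
  v ^- b_exp la * t ^+ (k * (k - 1) %/ 2)%N * (1 - v ^- 2) ^+ k
    * \prod_(a <- cells la) (1 - v ^- (2 * hook la a)%N)^-1.

Section Level.
Variable k : nat.
Local Notation H := (hecke v t k).

(* T_i, meaningful for 0 < i < k. *)
Definition hT (i : nat) : H :=
  if insub i.-1 is Some j then hecke_gen v t j else 0.

(* y_i, meaningful for 0 < i <= k. *)
Fixpoint jucys_murphy (i : nat) : H :=
  match i with
  | 0 | 1 => 1
  | i'.+1 => t ^- 2 *: (hT i' * jucys_murphy i' * hT i')
  end.

(* E for the tableau T restricted to the diagram D with r cells. All levels
   r <= k are computed in H_k, in which H_r is the subalgebra generated by
   T_1, ..., T_(r-1).                                                      *)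
Fixpoint tableau_idempotent (T : cell -> nat) (D : seq cell) (r : nat) : H :=
  match r with
  | 0 | 1 => 1
  | r'.+1 =>
      let a := cell_of T D r in
      let M := rem a D in
      let rho := [seq content c | c <- addable_cells M & c != a] in
      tableau_idempotent T M r' *
      ((\prod_(x <- rho) (content a - x))^-1 *:
         \prod_(x <- rho) (jucys_murphy r - x%:A))
  end.

Definition hT_longest : H :=
  \prod_(1 <= i < k) \prod_(j <- rev (iota 1 i)) hT j.

(* u_i, meaningful for 0 < i <= k. *)
Definition uvar (i : nat) : {mpoly F[k]} :=
  if insub i.-1 is Some j then 'X_j else 0.

Definition hT_xy (i : nat) (x y : {mpoly F[k]}) : ratfun _ k :=
  rf_add (rf_cst k (t^-1 *: hT i)) (rf_frac _ ((v^-1 - v) *: x) (y - x)).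

Definition Psi : ratfun _ k :=
  rf_mul
    (\big[@rf_mul _ _ _ / rf_cst k (1 : H)]_(1 <= i < k)
       \big[@rf_mul _ _ _ / rf_cst k (1 : H)]_(1 <= j < i.+1)
          hT_xy (i.+1 - j)%N (uvar j) (uvar i.+1))
    (rf_cst k hT_longest^-1).

End Level.

(* So the inverse in [Psi] is a genuine one. *)
Lemma hT_longest_unit k : v != 0 -> t != 0 -> hT_longest k \is a GRing.unit.
Proof.
move=> v0 t0.
have hTu i : (0 < i < k)%N -> hT k i \is a GRing.unit.
  case/andP=> i0 ik; rewrite /hT; case: insubP => [j _ _|]; last first.
    by move=> /negP[]; case: i i0 ik => // i _; case: (k).
  have := hecke_quad (hecke_gen_relations v t k) j; set T := hecke_gen v t j.
  rewrite mulrDr !mulrBl !mulr_algr mulr_algl scalerA => e.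
  pose Y : hecke v t k := t ^- 2 *: (T + ((v - v^-1) * t)%:A).
  have tt : v * t * (v^-1 * t) = t ^+ 2 by rewrite mulrACA mulfV // mul1r.
  have YT : Y * T = 1.
    rewrite /Y -scalerAl mulrDl mulr_algl mulrBl scalerBl.
    have -> : T * T + ((v * t) *: T - (v^-1 * t) *: T) = (t ^+ 2)%:A.
      apply/eqP; rewrite -subr_eq0 -e tt; apply/eqP; rewrite -!addrA.
      by congr (_ + _); rewrite addrCA.
    by rewrite scalerA mulVf ?scale1r // expf_neq0.
  have TY : T * Y = Y * T.
    rewrite /Y -scalerAr -scalerAl; congr (_ *: _).
    by rewrite mulrDr [RHS]mulrDl mulr_algl mulr_algr.
  by apply/unitrP; exists Y; split; rewrite ?TY.
rewrite /hT_longest big_nat_cond; apply: (big_ind (fun x => x \is a GRing.unit)).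
- exact: unitr1.
- by move=> x y ux uy; rewrite unitrMl.
move=> i; rewrite andbT => /andP[_ ik]; rewrite big_seq.
apply: (big_ind (fun x => x \is a GRing.unit)).
- exact: unitr1.
- by move=> x y ux uy; rewrite unitrMl.
move=> j; rewrite mem_rev mem_iota add1n ltnS => /andP[j0 ji].
by apply: hTu; rewrite j0 (leq_ltn_trans ji ik).
Qed.

End Fusion.

Definition Qvt : fieldType := {fraction {mpoly rat[2]}}.
Definition vQ : Qvt := tofrac ('X_(@Ordinal 2 0 isT) : {mpoly rat[2]}).
Definition tQ : Qvt := tofrac ('X_(@Ordinal 2 1 isT) : {mpoly rat[2]}).

(* Main.v *)
Require Import Defs.
From HB Require Import structures.
From mathcomp Require Import all_boot all_order all_algebra.
From mathcomp Require Import fraction mpoly.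
From mathcomp Require Import boolp.
From mathcomp Require Import ring zify.

Set Implicit Arguments.
Unset Strict Implicit.
Unset Printing Implicit Defensive.

Import Order.TTheory GRing.Theory Num.Theory.
Local Open Scope ring_scope.

(** Put s_i = t^-1 T_i, q = v^-1 - v and x = v^-2.  Then s_i^2 = 1 + q s_i, the
    Jucys-Murphy elements are y_1 = 1 and y_(i+1) = s_i y_i s_i, and a cell in
    row m and column n has content x^(n - m).

    Factorization.  The functions T_i(x, y) satisfy the Yang-Baxter equation, so
    the strand carrying u_k can be moved to the front of the product defining
    Psi.  Conjugation by T_(k-1) ... T_1 then undoes the shift of indices, and
    Psi(u_1, ..., u_k) is, up to a power of t, phi_k phi_(k-1) ... phi_2 with
    phi_m = T_(m-1)(u_(m-1), u_m) ... T_1(u_1, u_m) s_1^-1 ... s_(m-1)^-1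
    ([baxter_rows_fusion]).  The evaluation at u_m = sigma_m therefore concerns
    only phi_m(sigma_1, ..., sigma_(m-1), u) E_U, where U is the tableau formed
    by the first m - 1 cells.

    One factor.  If y_i z = sigma_i z for all i < m, an induction on m gives
    phi_m(u) (u - y_m) z = N(u) z, where N(u) is u - 1 times the product over
    i < m of (u - x^-1 sigma_i) (u - x sigma_i) / (u - sigma_i)^2
    ([fusion_row_weight]).  The eigenvalues of y_m on such z are contents of
    addable cells of U ([spectrum]), so that (u - y_m)^-1 E_U has only simple
    poles, and its residue at sigma_m is E_T.  On the other side N telescopes
    along the rows above the new cell and the columns to its left: N(u) equals
    (u - sigma_m) R(u) with R regular at sigma_m, and R(sigma_m) is the quotient
    of the hook products of the diagrams without and with the new cell
    ([fusion_scalar]).  Hence each evaluation exists and yields the next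
    idempotent times such a quotient ([fusion_step], [evaluation_step]).  After
    k steps the quotients multiply up to the inverse of the hook product of
    lambda, and f, which is this hook product times a power of t, leaves E_T.

    The spectrum.  That y_m has no other eigenvalues is proved inside the
    algebra, by induction on the tableau, following Okounkov and Vershik.  The
    intertwiner of y_(m-1) and y_m limits the candidates to the contents
    addable before the last cell and the two neighbours of the content of the
    last cell.  A repeated content is impossible because y_(m-1) acts
    semisimply ([eigenvalue_repeat]); a neighbour that is not addable would
    produce, after harmless exchanges of consecutive cells, the pattern a, b, a
    of contents with a, b adjacent, which contradicts the braid relation
    ([braid_pattern], [blocked_weight]). *)

(** * The fusion product in an algebra with Hecke generators *)

Section HeckeAlgebra.
Variables (C : comNzRingType) (B : algType C) (q : C) (k : nat) (s : nat -> B).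

(** The Hecke relations for the rescaled generators s_i = t^-1 T_i, over an
    arbitrary commutative ring of scalars: the same relations are used over
    the field and over the polynomials in the spectral parameters. *)
Record hecke_generators : Prop := HeckeGenerators {
  gen_braid : forall i, (0 < i)%N -> (i.+1 < k)%N ->
    s i * s i.+1 * s i = s i.+1 * s i * s i.+1;
  gen_comm : forall i j, (0 < i)%N -> (i.+1 < j)%N -> (j < k)%N ->
    s i * s j = s j * s i;
  gen_quad : forall i, (0 < i)%N -> (i < k)%N -> s i * s i = 1 + q *: s i }.

(** The Jucys-Murphy elements; the rescaling of the generators absorbs the
    factors t^-2. *)
Fixpoint jm (i : nat) : B :=
  match i with
  | 0 | 1 => 1
  | i'.+1 => s i' * jm i' * s i'
  end.

Arguments jm : simpl never.

Lemma jmS i : (0 < i)%N -> jm i.+1 = s i * jm i * s i.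
Proof. by case: i. Qed.

Hypothesis hs : hecke_generators.

Lemma gen_jm_comm_lt i j : (i < k)%N -> (j < i)%N -> GRing.comm (s i) (jm j).
Proof.
move=> ik; elim: j => [|[|j] IHj] ltji; try exact: commr1.
rewrite jmS //; have c : GRing.comm (s i) (s j.+1).
  by apply/commr_sym; exact: (gen_comm hs).
by apply: commrM => //; apply: commrM => //; apply: IHj; lia.
Qed.

Lemma gen_jm_comm_gt i j : (0 < i)%N -> (i.+1 < j)%N -> (j <= k)%N ->
  GRing.comm (s i) (jm j).
Proof.
move=> i0; elim: j => // j IHj; rewrite ltnS leq_eqVlt => /orP[/eqP <-|ltij] jk.
  rewrite !jmS //; have c : GRing.comm (s i.+1) (jm i) by apply: gen_jm_comm_lt.
  have b := gen_braid hs i0 jk; rewrite /GRing.comm.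
  (* s_i s_(i+1) s_i y_i s_i s_(i+1), with the braid relation used on each side of y_i *)
  transitivity (s i * s i.+1 * s i * jm i * s i * s i.+1); first by rewrite !mulrA.
  rewrite b -[_ * s i.+1 * jm i]mulrA c.
  transitivity (s i.+1 * s i * jm i * (s i.+1 * s i * s i.+1)).
    by rewrite !mulrA.
  by rewrite -b !mulrA.
have c : GRing.comm (s i) (s j) by apply: (gen_comm hs).
rewrite jmS; last lia.
by apply: commrM => //; apply: commrM => //; apply: IHj => //; exact: ltnW.
Qed.

Lemma gen_jm_comm i j : (0 < i)%N -> (i < k)%N -> (j <= k)%N ->
  j != i -> j != i.+1 -> GRing.comm (s i) (jm j).
Proof.
move=> i0 ik jk ji jSi; have [ltji|leij] := ltnP j i.
  exact: gen_jm_comm_lt.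
by apply: gen_jm_comm_gt => //; lia.
Qed.

Lemma jm_comm i j : (i <= k)%N -> (j <= k)%N -> GRing.comm (jm i) (jm j).
Proof.
wlog lij : i j / (i < j)%N.
  move=> H ik jk; case: (ltngtP i j) => [lij|lji|->] //; first exact: H.
  by apply/commr_sym/H.
move=> ik jk; elim: i lij ik => [|[|i] IHi] lij ik; try exact/commr_sym/commr1.
rewrite jmS //; apply/commr_sym.
have c : GRing.comm (jm j) (s i.+1) by apply/commr_sym/gen_jm_comm_gt.
apply: commrM => //; apply: commrM => //; apply/commr_sym/IHi; lia.
Qed.

Lemma gen_inv i : (0 < i)%N -> (i < k)%N -> (s i - q%:A) * s i = 1.
Proof.
by move=> i0 ik; rewrite mulrBl (gen_quad hs) // mulr_algl addrK.
Qed.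

(** As s_i - q inverts s_i, the definition of y_(i+1) reads y_i s_i = (s_i -
    q) y_(i+1). *)
Lemma jm_gen i : (0 < i)%N -> (i < k)%N ->
  jm i * s i = s i * jm i.+1 - q *: jm i.+1.
Proof.
move=> i0 ik; rewrite jmS // -mulr_algl -mulrBl !mulrA.
by rewrite (gen_inv i0 ik) mul1r.
Qed.

Lemma jmS_gen i : (0 < i)%N -> (i < k)%N ->
  jm i.+1 * s i = s i * jm i + q *: jm i.+1.
Proof.
move=> i0 ik; rewrite jmS // -[_ * s i * s i]mulrA (gen_quad hs) //.
by rewrite mulrDr mulr1 -scalerAr.
Qed.

(** The function T_i(x, y) multiplied by its denominator y - x. *)
Definition baxter (i : nat) (x y : C) : B := (y - x) *: s i + (q * x)%:A.

(** The strand y crosses the strands xs: T_(d+n)(x_1, y) ... T_(d+1)(x_n, y),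
    without denominators. The offset d shifts all indices. *)
Fixpoint baxter_row (d : nat) (xs : seq C) (y : C) : B :=
  if xs is x :: xs' then baxter (d + size xs').+1 x y * baxter_row d xs' y else 1.

(** The list carries the spectral parameters in reverse order, u_n first. With
    d = 0 this is the product that defines Psi, without denominators. *)
Fixpoint baxter_rows (d : nat) (ys : seq C) : B :=
  if ys is y :: ys' then baxter_rows d ys' * baxter_row d (rev ys') y else 1.

Lemma baxter_comm z i x y : GRing.comm z (s i) -> GRing.comm z (baxter i x y).
Proof.
move=> c; apply: commrD; last by rewrite /GRing.comm mulr_algl mulr_algr.
by rewrite /GRing.comm -scalerAr -scalerAl c.
Qed.

Lemma baxter_row_comm z d xs y :
  (forall i, (d < i)%N -> (i <= d + size xs)%N -> GRing.comm z (s i)) ->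
  GRing.comm z (baxter_row d xs y).
Proof.
elim: xs => [|x xs IHxs] /= c; first exact: commr1.
apply: commrM; first by apply/baxter_comm/c; lia.
by apply: IHxs => i di id; apply: c => //; lia.
Qed.

Lemma baxter_rows_comm z d ys :
  (forall i, (d < i)%N -> (i < d + size ys)%N -> GRing.comm z (s i)) ->
  GRing.comm z (baxter_rows d ys).
Proof.
elim: ys => [|y ys IHys] /= c; first exact: commr1.
apply: commrM; first by apply: IHys => i di id; apply: c => //; lia.
apply: baxter_row_comm; rewrite size_rev => i di id; apply: c => //; lia.
Qed.

(** The product is expanded on the words in p and r. The condition on the
    scalars gives p and r the same coefficient and makes the result symmetric
    under reversal of the factors, up to the braid relation; this is all of
    the Yang-Baxter equation. *)
Lemma affine_product (p r : B) (a a' b b' c c' : C) : p * p = 1 + q *: p ->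
  b' * (a * c * q + a * c' + a' * c) = a' * b * c' ->
  (a *: p + a'%:A) * (b *: r + b'%:A) * (c *: p + c'%:A) =
  (a * b * c) *: (p * r * p) + (a * b' * c + a' * b' * c')%:A
    + ((a * b * c') *: (p * r) + (a' * b * c) *: (r * p))
    + ((a' * b * c') *: p + (a' * b * c') *: r).
Proof.
move=> pp e.
have -> : (a *: p + a'%:A) * (b *: r + b'%:A) * (c *: p + c'%:A) =
    (a * b * c) *: (p * r * p) + (a * b' * c) *: (p * p)
      + (a' * b * c) *: (r * p) + (a' * b' * c) *: p
    + ((a * b * c') *: (p * r) + (a * b' * c') *: p + (a' * b * c') *: r
      + (a' * b' * c')%:A).
  rewrite mulrDr !mulrDl !mulrDr !mulr_algr !mulr_algl.
  rewrite !mulrDl !scalerDr -!scalerAl -!scalerAr -!scalerAl !mul1r !scalerA.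
  rewrite !addrA; do !congr (_ + _); congr (_ *: _); ring.
rewrite -e pp !scalerDr.
have -> : b' * (a * c * q + a * c' + a' * c) =
  a * b' * c * q + a' * b' * c + a * b' * c' by ring.
rewrite !scalerDl !scalerA.
by rewrite [LHS](AC ((1*2)*1*1*4) ((1*(2*9))*(6*4)*((3*5*7)*8))).
Qed.

Lemma yang_baxter i x y z : (0 < i)%N -> (i.+1 < k)%N ->
  baxter i x y * baxter i.+1 x z * baxter i y z =
  baxter i.+1 y z * baxter i x z * baxter i.+1 x y.
Proof.
move=> i0 ik; rewrite !affine_product; try ring; try apply: (gen_quad hs) => //; last exact: ltnW.
rewrite (gen_braid hs) //.
congr (_ + _ + _); last rewrite [LHS]addrC.
- by congr (_ *: _ + _ *: _); ring.
- by rewrite [RHS]addrC; congr (_ *: _ + _ *: _); ring.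
by congr (_ *: _ + _ *: _); ring.
Qed.

(** The strands u and y cross xs and each other. By the Yang-Baxter equation
    the mutual crossing may be done first instead of last; the strands of xs
    are dealt with one at a time. *)
Lemma baxter_row_crossing d xs u y : ((d + size xs).+1 < k)%N ->
  baxter_row d xs u * baxter_row d (rcons xs u) y =
  baxter (d + size xs).+1 u y * (baxter_row d xs y * baxter_row d.+1 xs u).
Proof.
elim: xs => [|x xs IHxs] /= dk; first by rewrite !addn0 mul1r !mulr1.
rewrite size_rcons.
have c1 : baxter_row d xs u * baxter (d + (size xs).+1).+1 x y =
    baxter (d + (size xs).+1).+1 x y * baxter_row d xs u.
  apply/commr_sym/commr_sym/baxter_comm/commr_sym/baxter_row_comm => i di id.
  apply/commr_sym/(gen_comm hs); lia.
have c2 : baxter (d + (size xs).+1).+1 x u * baxter_row d xs y =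
    baxter_row d xs y * baxter (d + (size xs).+1).+1 x u.
  apply/commr_sym/baxter_comm/commr_sym/baxter_row_comm => i di id.
  apply/commr_sym/(gen_comm hs); lia.
rewrite !mulrA -[_ * baxter_row d xs u * baxter _ x y]mulrA c1 -!mulrA IHxs; last lia.
rewrite addSn addnS !mulrA yang_baxter //; last lia.
by rewrite -addnS -!mulrA; do 2!congr (_ * _); rewrite !mulrA c2.
Qed.

(** The last strand y crosses the others at the beginning of the product
    instead of at its end; the remaining crossings then take place one
    position higher. *)
Lemma baxter_rows_cons d y ys : (d + size ys < k)%N ->
  baxter_rows d (y :: ys) = baxter_row d ys y * baxter_rows d.+1 ys.
Proof.
elim: ys y => [|u ys IHys] y /= dk; first by rewrite mulr1.
have c : baxter_rows d ys * baxter (d + size ys).+1 u y =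
    baxter (d + size ys).+1 u y * baxter_rows d ys.
  apply/commr_sym/commr_sym/baxter_comm/commr_sym/baxter_rows_comm => i di id.
  apply/commr_sym/(gen_comm hs); lia.
rewrite rev_cons -mulrA baxter_row_crossing size_rev; last lia.
rewrite mulrA c -!mulrA; congr (_ * _).
by rewrite mulrA [_ * baxter_row d _ y]IHys ?mulrA //; lia.
Qed.

Fixpoint cox (n : nat) : B := if n is n'.+1 then s n * cox n' else 1.

(** In the normalization s_i, the basis element of the longest permutation of
    n letters. *)
Fixpoint longest (n : nat) : B :=
  if n is n'.+1 then longest n' * cox n' else 1.

(** The factor phi_m(x_1, ..., x_(m-1), y) without denominators, the list
    being x_(m-1), ..., x_1. The inverses of the generators are s_i - q. *)
Fixpoint fusion_row (xs : seq C) (y : C) : B :=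
  if xs is x :: xs' then
    baxter (size xs').+1 x y * fusion_row xs' y * (s (size xs').+1 - q%:A)
  else 1.

(** A product of fusion factors in which the parameters in the list xs have
    already been processed: this is the shape of Psi after the first
    evaluations, when xs consists of contents. *)
Fixpoint fusion_rows (ys xs : seq C) : B :=
  if ys is y :: ys' then fusion_row (ys' ++ xs) y * fusion_rows ys' xs else 1.

Lemma fusion_row_cox xs y : (size xs < k)%N ->
  baxter_row 0 xs y = fusion_row xs y * cox (size xs).
Proof.
elim: xs => [|x xs IHxs] /= xk; first by rewrite mulr1.
rewrite add0n -!mulrA; congr (_ * _).
by rewrite [_ * (s _ * _)]mulrA gen_inv // mul1r; apply: IHxs; exact: ltnW.
Qed.

Lemma cox_comm z n : (forall i, (0 < i)%N -> (i <= n)%N -> GRing.comm z (s i)) ->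
  GRing.comm z (cox n).
Proof.
elim: n => [|n IHn] c; first exact: commr1.
by apply: commrM; [exact: c | apply: IHn => i i0 /leqW; exact: c].
Qed.

(** Conjugation by s_n ... s_1 lowers the index of a generator by one; it
    undoes the shift in [baxter_rows_cons]. *)
Lemma cox_shift n i : (0 < i)%N -> (i < n)%N -> (n < k)%N ->
  cox n * s i.+1 = s i * cox n.
Proof.
elim: n i => // n IHn i i0; rewrite ltnS leq_eqVlt => /orP[/eqP ei|ltin] nk.
  move: i0 nk; rewrite {i}ei; case: n {IHn} => //= n _ nk.
  have c : GRing.comm (s n.+2) (cox n).
    apply: cox_comm => i i0 ik; apply/commr_sym/(gen_comm hs) => //; lia.
  by rewrite -!mulrA -c !mulrA (gen_braid hs).
rewrite /= -mulrA IHn //; last exact: ltnW.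
by rewrite !mulrA -[s n.+1 * s i](gen_comm hs).
Qed.

Lemma cox_baxter n i x y : (0 < i)%N -> (i < n)%N -> (n < k)%N ->
  cox n * baxter i.+1 x y = baxter i x y * cox n.
Proof.
move=> i0 ltin nk; rewrite /baxter mulrDr mulrDl -scalerAr -scalerAl.
by rewrite cox_shift // mulr_algl mulr_algr.
Qed.

Lemma cox_row n xs y : (size xs < n)%N -> (n < k)%N ->
  cox n * baxter_row 1 xs y = baxter_row 0 xs y * cox n.
Proof.
elim: xs => [|x xs IHxs] /= xn nk; first by rewrite mulr1 mul1r.
by rewrite mulrA cox_baxter // -mulrA IHxs ?mulrA //; exact: ltnW.
Qed.

Lemma cox_rows n ys : (size ys <= n)%N -> (n < k)%N ->
  cox n * baxter_rows 1 ys = baxter_rows 0 ys * cox n.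
Proof.
elim: ys => [|y ys IHys] /= yn nk; first by rewrite mulr1 mul1r.
rewrite mulrA IHys //; last exact: ltnW.
by rewrite -!mulrA cox_row ?size_rev.
Qed.

(** The factorization of Psi. The factor s_n ... s_1 split off from the
    longest element turns the first row into a fusion factor and shifts the
    remaining rows back. *)
Lemma baxter_rows_fusion ys : (size ys <= k)%N ->
  baxter_rows 0 ys = fusion_rows ys [::] * longest (size ys).
Proof.
elim: ys => [|y ys IHys] yk; first by rewrite mulr1.
rewrite baxter_rows_cons // fusion_row_cox // -mulrA cox_rows // IHys; last exact: ltnW.
by rewrite /= cats0 !mulrA.
Qed.

Lemma fusion_rows_rcons ys y xs :
  fusion_rows (rcons ys y) xs = fusion_rows ys (y :: xs) * fusion_row xs y.
Proof.
elim: ys => [|z ys IHys] /=; first by rewrite mul1r mulr1.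
by rewrite IHys mulrA -cats1 -catA.
Qed.

(** The list is x_r, ..., x_1, and z is an eigenvector of y_i for x_i, for all
    i up to r. *)
Fixpoint weight (xs : seq C) (z : B) : Prop :=
  if xs is x :: xs' then weight xs' z /\ jm (size xs) * z = x *: z else True.

Lemma weight_mull xs z w :
  (forall i, (0 < i)%N -> (i <= size xs)%N -> GRing.comm w (jm i)) ->
  weight xs z -> weight xs (w * z).
Proof.
elim: xs => //= x xs IHxs c [wz e]; split.
  by apply: IHxs wz => i i0 /leqW; exact: c.
by rewrite mulrA -c // -mulrA e scalerAr.
Qed.

Lemma weight_mulr xs z w : weight xs z -> weight xs (z * w).
Proof.
elim: xs => //= x xs IHxs [wz e]; split; first exact: IHxs.
by rewrite mulrA e scalerAl.
Qed.

Lemma weight_gen xs z i : (size xs < i)%N -> (i < k)%N -> weight xs z ->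
  weight xs (s i * z).
Proof.
move=> xi ik; apply: weight_mull => j j0 jx.
by apply: gen_jm_comm_lt => //; exact: leq_ltn_trans xi.
Qed.

(** Induction on the number of strands, moving u - y_(n+1) past s_n^-1: since
    s_n^-1 y_(n+1) = y_n s_n, the claim for n applies to s_n z and to z, both
    of which have the shorter weight. What is left is ((u - x) s_n + q x) ((u
    - x) s_n - q u) z, a scalar by the quadratic relation. *)
Lemma fusion_row_weight xs u z : (size xs < k)%N -> weight xs z ->
  (\prod_(x <- xs) (u - x)) *:
     (fusion_row xs u * (u *: z - jm (size xs).+1 * z)) =
  ((u - 1) * \prod_(x <- xs) ((u - x) ^+ 2 - q ^+ 2 * x * u)) *: z.
Proof.
elim: xs z => [|x xs IHxs] z xk.
  by rewrite !big_nil scale1r mulr1 !mul1r scalerBl scale1r.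
move=> [wz ez]; set n := (size xs).+1; rewrite -/n in ez.
have nk : (n < k)%N by [].
pose P := \prod_(x <- xs) (u - x); pose N := \prod_(x <- xs) ((u - x) ^+ 2 - q ^+ 2 * x * u).
rewrite !big_cons /= -/n -/P -/N.
have ws := weight_gen (ltnSn _) nk wz.
have e1 : (s n - q%:A) * (u *: z - jm n.+1 * z) =
    (u *: (s n * z) - jm n * (s n * z)) - (q * u) *: z.
  rewrite mulrBr -scalerAr [_ * (jm _ * z)]mulrA jmS // !mulrA.
  rewrite (gen_inv _ nk) // mul1r -mulrA.
  by rewrite mulrBl scalerBr mulr_algl scalerA [u * q]mulrC addrAC.
have e2 := IHxs _ (ltnW xk) ws; have e3 := IHxs _ (ltnW xk) wz.
rewrite -/n -/P -/N ez -scalerBl -scalerAr in e2 e3.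
transitivity (baxter n x u * ((u - x) *: (P *: (fusion_row xs u * (u *: (s n * z) - jm n * (s n * z))))
   - (q * u) *: (P *: ((u - x) *: (fusion_row xs u * z))))).
  rewrite -[_ * (s n - _) * _]mulrA e1 -[baxter n x u * _ * _]mulrA mulrBr.
  rewrite scalerAr scalerBr; congr (_ * (_ - _)); rewrite -?scalerAr !scalerA //.
  by congr (_ *: _); ring.
rewrite e2 e3.
have -> : (u - x) *: (((u - 1) * N) *: (s n * z)) -
    (q * u) *: (((u - 1) * N) *: z) =
    ((u - 1) * N) *: ((u - x) *: (s n * z) - (q * u) *: z).
  by rewrite scalerBr !scalerA; congr (_ *: _ - _ *: _); ring.
rewrite -scalerAr [RHS](_ : _ = ((u - 1) * N) *:
    (((u - x) ^+ 2 - q ^+ 2 * x * u) *: z)); last first.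
  by rewrite scalerA; congr (_ *: _); ring.
congr (_ *: _); rewrite /baxter mulrDl mulr_algl -scalerAl !mulrBr.
rewrite -!scalerAr mulrA (gen_quad hs) // mulrDl mul1r -scalerAl.
rewrite !scalerBr !scalerDr !scalerA.
rewrite [LHS](AC (3*2) ((1*5)*(2*3*4))) /= -!scalerBl -scalerDl.
rewrite [X in _ + X *: _](_ : _ = 0) ?scale0r ?addr0; last by ring.
by congr (_ *: _); ring.
Qed.
End HeckeAlgebra.

Arguments jm : simpl never.

(** * Intertwiners of consecutive Jucys-Murphy elements *)

Section Intertwiner.
Variables (C : comNzRingType) (B : algType C) (q : C) (k : nat) (s : nat -> B).
Hypothesis hs : hecke_generators q k s.
Local Notation y := (jm s).

Definition root_prod (Y : B) (cs : seq C) : B := \prod_(c <- cs) (Y - c%:A).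

Lemma root_prod_cons Y c cs : root_prod Y (c :: cs) = (Y - c%:A) * root_prod Y cs.
Proof. exact: big_cons. Qed.

Lemma root_prod_comm z Y cs : GRing.comm z Y -> GRing.comm z (root_prod Y cs).
Proof.
move=> c; apply: commr_prod => x _; apply: commrB => //.
by rewrite /GRing.comm mulr_algl mulr_algr.
Qed.

Lemma root_prod_cat Y cs cs' :
  root_prod Y (cs ++ cs') = root_prod Y cs * root_prod Y cs'.
Proof. exact: big_cat. Qed.

Lemma root_prodC Y cs cs' :
  root_prod Y cs * root_prod Y cs' = root_prod Y cs' * root_prod Y cs.
Proof. by apply/root_prod_comm/commr_sym/root_prod_comm/commr_refl. Qed.

Lemma root_prodC1 Y c cs :
  (Y - c%:A) * root_prod Y cs = root_prod Y cs * (Y - c%:A).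
Proof.
apply/root_prod_comm/commr_sym/commrB; first exact: commr_refl.
by rewrite /GRing.comm mulr_algl mulr_algr.
Qed.

Lemma root_prod_perm Y cs cs' : perm_eq cs cs' -> root_prod Y cs = root_prod Y cs'.
Proof.
elim: cs cs' => [|c cs IHcs] cs'.
  by move=> p; have /perm_nilP-> : perm_eq cs' [::] by rewrite perm_sym.
move=> p; have cin : c \in cs' by rewrite -(perm_mem p) mem_head.
case/splitPr: cin p => l1 l2 p.
rewrite root_prod_cons (IHcs (l1 ++ l2)); last first.
  by rewrite -(perm_cons c) (permPl p) perm_catC /= perm_cons perm_catC.
rewrite !root_prod_cat root_prod_cons !mulrA; congr (_ * _).
have := root_prodC Y [:: c] l1; rewrite root_prod_cons [root_prod Y [::]]big_nil.
by rewrite mulr1.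
Qed.

Lemma root_prod_eigen Y cs c z : Y * z = c *: z ->
  root_prod Y cs * z = (\prod_(x <- cs) (c - x)) *: z.
Proof.
move=> e; elim: cs => [|x cs IHcs]; first by rewrite /root_prod !big_nil mul1r scale1r.
rewrite root_prod_cons big_cons -mulrA IHcs -scalerAr mulrBl e mulr_algl.
by rewrite -scalerBl scalerA mulrC.
Qed.

Lemma uniq_sub_perm (T : eqType) (s1 s2 : seq T) : uniq s1 ->
  {subset s1 <= s2} -> exists l, perm_eq s2 (s1 ++ l).
Proof.
elim: s1 s2 => [|c s1 IHs] s2 /=; first by exists s2.
case/andP=> cs1 u1 sub; have cs2 : c \in s2 by apply: sub; rewrite mem_head.
have [|l p] := IHs (rem c s2) u1.
  move=> z zs1; have := sub z; rewrite inE zs1 orbT => /(_ isT) zs2.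
  have := perm_mem (perm_to_rem cs2) z; rewrite zs2 inE.
  by case: eqP => // ez; move: cs1; rewrite -ez zs1.
by exists l; rewrite (permPl (perm_to_rem cs2)) perm_cons.
Qed.

(** A root c of an annihilating product can be removed when c is not an
    eigenvalue on the vectors M: the product of the other factors applied to x
    is an eigenvector for c. *)
Lemma root_prod_shrink (M : B -> Prop) Y cs cs' x :
  (forall c z, M z -> M ((Y - c%:A) * z)) ->
  (forall c z, c \in cs -> c \notin cs' -> M z -> Y * z = c *: z -> z = 0) ->
  M x -> uniq cs -> root_prod Y cs * x = 0 -> root_prod Y cs' * x = 0.
Proof.
move=> cM ev Mx u e.
have {u} u : uniq (filter (mem cs') cs) by exact: filter_uniq.
have {e} e : root_prod Y (filter (mem cs') cs) * x = 0.
  have Mp l z : M z -> M (root_prod Y l * z).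
    elim: l => [|c l IHl] Mz; first by rewrite /root_prod big_nil mul1r.
    by rewrite root_prod_cons -mulrA; apply/cM/IHl.
  elim: cs x Mx ev e {u} => [|c cs IHcs] x Mx ev //=.
  rewrite root_prod_cons root_prodC1.
  rewrite -mulrA => /IHcs-/(_ (cM _ _ Mx)) e.
  have {}e : root_prod Y [seq i <- cs | mem cs' i] * ((Y - c%:A) * x) = 0.
    by apply: e => c0 z c0in; apply: ev; rewrite inE c0in orbT.
  rewrite mulrA -root_prodC1 -mulrA in e.
  case: ifP => ccs'; first by rewrite root_prod_cons -mulrA.
  apply: (ev c); [exact: mem_head | exact/negbT | exact: Mp |].
  by apply/eqP; rewrite -subr_eq0 -[c *: _]mulr_algl -mulrBl; apply/eqP.
have [|l p] := @uniq_sub_perm C _ cs' u.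
  by move=> c; rewrite mem_filter => /andP[].
by rewrite (root_prod_perm _ p) root_prod_cat root_prodC -mulrA e mulr0.
Qed.

Section Exchange.
Variable i : nat.
Hypotheses (i0 : (0 < i)%N) (ik : (i < k)%N).

Lemma jm_gen_eigen a b w : y i * w = a *: w -> y i.+1 * w = b *: w ->
  y i * (s i * w) = b *: (s i * w) - (q * b) *: w.
Proof.
move=> ea eb; rewrite mulrA (jm_gen hs) // mulrBl -mulrA eb -scalerAl eb.
by rewrite -scalerAr scalerA.
Qed.

Lemma jmS_gen_eigen a b w : y i * w = a *: w -> y i.+1 * w = b *: w ->
  y i.+1 * (s i * w) = a *: (s i * w) + (q * b) *: w.
Proof.
move=> ea eb; rewrite mulrA (jmS_gen hs) // mulrDl -mulrA ea -scalerAl eb.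
by rewrite -scalerAr scalerA.
Qed.

(** The intertwiner s_i (y_i - y_(i+1)) + q y_(i+1) applied to a joint
    eigenvector w with eigenvalues a and b. *)
Definition exchange (a b : C) (w : B) : B := (a - b) *: (s i * w) + (q * b) *: w.

Lemma exchange_lower a b w : y i * w = a *: w -> y i.+1 * w = b *: w ->
  y i * exchange a b w = b *: exchange a b w.
Proof.
move=> ea eb; rewrite /exchange mulrDr -!scalerAr (jm_gen_eigen ea eb) ea.
rewrite !scalerDr scalerN !scalerA -addrA [- _ + _]addrC -scalerBl.
by congr (_ *: _ + _ *: _); ring.
Qed.

Lemma exchange_upper a b w : y i * w = a *: w -> y i.+1 * w = b *: w ->
  y i.+1 * exchange a b w = a *: exchange a b w.
Proof.
move=> ea eb; rewrite /exchange mulrDr -!scalerAr (jmS_gen_eigen ea eb) eb.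
rewrite !scalerDr !scalerA -addrA -scalerDl.
by congr (_ *: _ + _ *: _); ring.
Qed.

(** Over a field with q = v^-1 - v, the coefficient vanishes only if a = v^2 b
    or b = v^2 a; in all other cases an exchange loses no information. *)
Lemma exchange_twice a b w :
  exchange b a (exchange a b w) = (q ^+ 2 * a * b - (a - b) ^+ 2) *: w.
Proof.
rewrite /exchange mulrDr -!scalerAr mulrA (gen_quad hs) // mulrDl mul1r.
rewrite -scalerAl !scalerDr !scalerA.
rewrite [LHS](AC (3*2) ((1*5)*(2*3*4))) /= -!scalerDl.
rewrite [X in _ + X *: _](_ : _ = 0) ?scale0r ?addr0; last by ring.
by congr (_ *: _); ring.
Qed.

(** The same intertwiner on a vector that is an eigenvector of y_i only. *)
Definition intertwiner (a : C) (x : B) : B :=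
  s i * (a *: x - y i.+1 * x) + q *: (y i.+1 * x).

Lemma intertwinerP a x : y i * x = a *: x ->
  y i * intertwiner a x = intertwiner a (y i.+1 * x).
Proof.
move=> ea; have c : y i * y i.+1 = y i.+1 * y i by apply: (jm_comm hs); lia.
rewrite /intertwiner mulrDr -scalerAr !mulrA (jm_gen hs) // c.
rewrite -!mulrA ea mulrBl -!mulrA -!scalerAr -scalerAl.
rewrite !mulrBr !scalerBr -!scalerAr !scalerA.
rewrite [q * a]mulrC.
by rewrite opprB [LHS](AC (2*2*1) ((1*2*3)*(4*5))) /= addNr addr0.
Qed.

(** This is the square of the intertwiner, (y_i - y_(i+1))^2 - q^2 y_i y_(i+1)
    up to sign. It bounds the eigenvalues of y_(i+1) when the intertwined
    vector vanishes. *)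
Lemma intertwiner_eq0 a x : y i * x = a *: x -> intertwiner a x = 0 ->
  (a ^+ 2) *: x - ((2 + q ^+ 2) * a) *: (y i.+1 * x)
    + y i.+1 * (y i.+1 * x) = 0.
Proof.
move=> ea e0; have := intertwinerP ea; rewrite e0 mulr0 => /esym e1.
have sE w w1 : s i * (s i * (a *: w - w1) + q *: w1) =
    (a *: w - w1) + (q * a) *: (s i * w).
  rewrite mulrDr mulrA (gen_quad hs) // mulrDl mul1r -scalerAl -scalerAr.
  by rewrite mulrBr scalerBr -scalerAr scalerA -!addrA addNr addr0.
have := sE x (y i.+1 * x); have := sE (y i.+1 * x) (y i.+1 * (y i.+1 * x)).
rewrite -/(intertwiner a x) -/(intertwiner a (y i.+1 * x)) e0 e1 mulr0.
move: e0; rewrite /intertwiner; set x1 := y i.+1 * x; set x2 := y i.+1 * x1.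
rewrite mulrBr -scalerAr; set u := s i * x; set w := s i * x1 => e0 e3 e2.
have : (a *: x1 - x2 + (q * a) *: w) - a *: (a *: x - x1 + (q * a) *: u)
   + (q * a) *: (a *: u - w + q *: x1) = 0.
  by rewrite -e3 -e2 e0 !scaler0 subr0 addr0.
rewrite !scalerDr !scalerN !scalerA !opprD !opprK.
move=> /eqP; rewrite -oppr_eq0 => /eqP <-.
rewrite !opprD !opprK.
rewrite [RHS](AC (3*3*3) (((4*((1*5)*9))*2)*((6*7)*(3*8)))) /= addNr addr0.
rewrite [a * (q * a)]mulrCA mulrA subrr addr0 -!opprD -!scalerDl.
by congr (_ *: _ - _ *: _ + _); ring.
Qed.

End Exchange.

End Intertwiner.

(** * Diagrams built one cell at a time *)

(** For the diagrams built below this agrees with being addable, see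
    [can_addP], but it only looks at the cells above and to the left of c. *)
Definition can_add (D : seq cell) (c : cell) : bool :=
  [&& c \notin D, (0 < c.1)%N, (0 < c.2)%N,
      (c.1 == 1%N) || ((c.1.-1, c.2) \in D)
    & (c.2 == 1%N) || ((c.1, c.2.-1) \in D)].

(** A standard tableau encoded as the list of its cells in the reverse order
    of their entries: each cell can be added to the diagram formed by the
    cells that follow it. *)
Fixpoint standard (D : seq cell) : bool :=
  if D is c :: D' then standard D' && can_add D' c else true.

Definition diagonal (c : cell) : int := c.2%:Z - c.1%:Z.

Lemma can_add_eq D D' c : D =i D' -> can_add D c = can_add D' c.
Proof. by move=> e; rewrite /can_add !e. Qed.

Lemma standard_uniq D : standard D -> uniq D.
Proof. by elim: D => //= c D IHD /andP[/IHD-> /and5P[->]]. Qed.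

Lemma standard_pos D m n : standard D -> (m, n) \in D -> (0 < m)%N && (0 < n)%N.
Proof.
elim: D => //= c D IHD /andP[sD /and5P[_ c1 c2 _ _]].
by rewrite inE => /orP[/eqP e|/(IHD sD)//]; move: c1 c2; rewrite -e => /= -> ->.
Qed.

Lemma standard_lower D m n m' n' : standard D -> (m, n) \in D ->
  (0 < m' <= m)%N -> (0 < n' <= n)%N -> (m', n') \in D.
Proof.
elim: D m n => //= -[i j] D IHD m n /andP[sD /and5P[/= _ i0 j0 hi hj]].
rewrite !inE => /orP[/eqP[-> ->]|mD] hm hn; last first.
  by rewrite (IHD _ _ sD mD hm hn) orbT.
have [ei|nei] := eqVneq m' i; last first.
  case/orP: hi => [/eqP i1|hi]; first by move: hm nei; rewrite i1; lia.
  by rewrite (IHD _ _ sD hi) ?orbT //; lia.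
have [ej|nej] := eqVneq n' j; first by rewrite ei ej eqxx.
case/orP: hj => [/eqP j1|hj]; first by move: hn nej; rewrite j1; lia.
by rewrite (IHD _ _ sD hj) ?orbT //; lia.
Qed.

(** Two addable cells lie strictly south-west and north-east of each other, so
    their contents are neither equal nor adjacent. *)
Lemma can_add_gap D c c' : standard D -> can_add D c -> can_add D c' -> c != c' ->
  (diagonal c + 2 <= diagonal c') \/ (diagonal c' + 2 <= diagonal c).
Proof.
wlog lt : c c' / (c.1 < c'.1)%N \/ (c.1 = c'.1 /\ c.2 < c'.2)%N.
  move=> H sD a a' ne.
  have [lt|lt|e] := ltngtP c.1 c'.1; first by apply: H => //; left.
    by rewrite or_comm; apply: H => //; [left | rewrite eq_sym].
  have [lt|lt|e2] := ltngtP c.2 c'.2; first by apply: H => //; right.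
    by rewrite or_comm; apply: H => //; [right | rewrite eq_sym].
  by case/eqP: ne; case: (c) (c') e e2 => ? ? [? ?] /= -> ->.
case: c c' lt => [m n] [m' n'] /= lt sD /and5P[/= nD m0 n0 _ _].
move=> /and5P[/= nD' m0' n0' hm hn] _; rewrite /diagonal /=.
case: lt => [lt|[e lt]]; last first.
  case/orP: hn => [/eqP|] hn; first by lia.
  by case/negP: nD; apply: (standard_lower sD hn); lia.
case/orP: hm => [/eqP|] hm; first by lia.
have [|le] := ltnP n' n; first by lia.
by case/negP: nD; apply: (standard_lower sD hm); lia.
Qed.

Lemma standard_swap c g V : standard (c :: g :: V) ->
  c != (g.1.+1, g.2) -> c != (g.1, g.2.+1) -> standard (g :: c :: V).
Proof.
case: c g => [m n] [i j] /= /andP[/andP[sV /and5P[/= gV i0 j0 k1 k2]]].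
move=> /and5P[/= cgV m0 n0 h1 h2] ne1 ne2.
have {cgV} [cg cV] : (m, n) != (i, j) /\ (m, n) \notin V.
  by move: cgV; rewrite inE negb_or => /andP[].
rewrite sV /can_add /= cV m0 n0 i0 j0 !inE negb_or [(i, j) == _]eq_sym cg gV /=.
apply/andP; split; apply/andP; split; last 2 first.
- by case/orP: k1 => ->; rewrite ?orbT.
- by case/orP: k2 => ->; rewrite ?orbT.
- case/orP: h1 => [->//|]; rewrite inE => /orP[/eqP[e1 e2]|->]; last by rewrite orbT.
  by case/eqP: ne1; congr (_, _) => //; lia.
case/orP: h2 => [->//|]; rewrite inE => /orP[/eqP[e1 e2]|->]; last by rewrite orbT.
by case/eqP: ne2; congr (_, _) => //; lia.
Qed.

Lemma standard_cat_eq pre V V' : V =i V' -> standard V' ->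
  standard (pre ++ V) -> standard (pre ++ V').
Proof.
move=> e sV'; elim: pre => //= c pre IHpre /andP[/IHpre-> a] /=.
by rewrite -(@can_add_eq (pre ++ V)) // => z; rewrite !mem_cat e.
Qed.

Lemma can_add_cons D c c' : can_add D c -> c != c' -> can_add (c' :: D) c.
Proof.
move=> /and5P[cn c1 c2 h1 h2] ne; apply/and5P; split=> //.
- by rewrite inE negb_or ne.
- by case/orP: h1 => [->//|h1]; rewrite inE h1 !orbT.
by case/orP: h2 => [->//|h2]; rewrite inE h2 !orbT.
Qed.

Definition row_len (D : seq cell) (m : nat) := count (fun c => c.1 == m) D.
Definition col_len (D : seq cell) (n : nat) := count (fun c => c.2 == n) D.

(** A downward closed finite set of positive integers is an initial segment;
    applied to the rows of a diagram. *)
Lemma nat_segment (s : seq nat) a : uniq s ->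
  (forall i, i \in s -> (0 < i)%N) ->
  (forall i j, i \in s -> (0 < j <= i)%N -> j \in s) ->
  (a \in s) = (0 < a <= size s)%N.
Proof.
move=> u pos low.
have sub i : i \in s -> (i <= size s)%N.
  move=> ins; rewrite -(size_iota 1 i); apply: uniq_leq_size; first exact: iota_uniq.
  by move=> j; rewrite mem_iota add1n ltnS => hj; exact: (low i).
have e : s =i iota 1 (size s).
  have su : {subset s <= iota 1 (size s)}.
    by move=> i ins; rewrite mem_iota add1n ltnS pos ?sub.
  by apply: (uniq_min_size u su _).2; rewrite size_iota.
by rewrite e mem_iota add1n ltnS.
Qed.

Lemma mem_row_len D m n : standard D ->
  ((m, n) \in D) = [&& (0 < m)%N, (0 < n)%N & (n <= row_len D m)%N].
Proof.
move=> sD; pose s := [seq c.2 | c <- D & c.1 == m].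
have ms i : (i \in s) = ((m, i) \in D).
  apply/mapP/idP => [[[a b]]|mi]; last by exists (m, i); rewrite // mem_filter eqxx.
  by rewrite mem_filter /= => /andP[/eqP<- h] ->.
have u : uniq s.
  rewrite map_inj_in_uniq ?filter_uniq ?standard_uniq // => -[a b] [a' b'].
  by rewrite !mem_filter /= => /andP[/eqP-> _] /andP[/eqP-> _] ->.
have seg : ((m, n) \in D) = (0 < n <= row_len D m)%N.
  rewrite -ms /row_len -size_filter -(size_map snd); apply: nat_segment => //.
    by move=> i; rewrite ms => /(standard_pos sD)/andP[].
  move=> i j; rewrite !ms => hi hj; apply: (standard_lower sD hi) => //.
  by have := standard_pos sD hi; lia.
case: posnP => [m0|_]; last exact: seg.
by apply/negP => /(standard_pos sD); rewrite m0.
Qed.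

Definition transpose (D : seq cell) : seq cell := [seq (c.2, c.1) | c <- D].

Lemma mem_transpose D m n : ((m, n) \in transpose D) = ((n, m) \in D).
Proof.
apply/mapP/idP => [[[a b] h [-> ->]] //|h]; by exists (n, m).
Qed.

Lemma standard_transpose D : standard D -> standard (transpose D).
Proof.
elim: D => //= -[m n] D IHD /andP[/IHD-> /and5P[/= cn m0 n0 h1 h2]].
by rewrite /can_add /= -/(transpose D) !mem_transpose cn m0 n0 h1 h2.
Qed.

Lemma mem_col_len D m n : standard D ->
  ((m, n) \in D) = [&& (0 < m)%N, (0 < n)%N & (m <= col_len D n)%N].
Proof.
move=> sD; rewrite -mem_transpose (mem_row_len _ _ (standard_transpose sD)).
have -> : row_len (transpose D) n = col_len D n by rewrite /row_len count_map.
by rewrite andbCA.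
Qed.

Lemma standard_young D : standard D -> young_diagram D.
Proof.
move=> sD; exists [seq row_len D m | m <- iota 1 (col_len D 1)].
  apply/andP; split.
    apply/(sortedP 0%N) => i; rewrite size_map size_iota => ik.
    rewrite !(nth_map 0%N) ?size_iota ?(ltnW ik) // !nth_iota ?(ltnW ik) //.
    rewrite /geq /=; case: (posnP (row_len D (1 + i.+1))) => [->//|r0].
    have : (1 + i.+1, row_len D (1 + i.+1))%N \in D by rewrite mem_row_len // r0 leqnn.
    move=> /(standard_lower sD)-/(_ (1 + i)%N (row_len D (1 + i.+1))).
    by rewrite mem_row_len // r0 leqnn /=; apply; lia.
  apply/negP => /mapP[m]; rewrite mem_iota add1n ltnS => /andP[m0 mk] e.
  have : (m, 1%N) \in D by rewrite mem_col_len // m0.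
  by rewrite mem_row_len // -e andbF.
move=> [m n]; rewrite mem_cells size_map size_iota.
have [m0|//] := posnP m; first by rewrite mem_row_len // m0.
move=> m0 /=; have [mk|mk] := leqP m (col_len D 1); last first.
  apply/esym/negP => h; have /andP[_ n0] := standard_pos sD h.
  have : (m, 1%N) \in D by apply: (standard_lower sD h); lia.
  by rewrite mem_col_len //; lia.
rewrite (nth_map 0%N) ?size_iota; last by lia.
by rewrite nth_iota ?mem_row_len // ?add1n ?prednK ?m0.
Qed.

Lemma can_addP D c : standard D -> addable D c <-> can_add D c.
Proof.
move=> sD; split=> [[cn [la /andP[so la0] e]]|a]; last first.
  by split; [case/and5P: a | apply: standard_young; rewrite /= sD].
case: c cn e => m n cn e.
have := e (m, n); rewrite mem_cells mem_head => /and4P[m0 ms n0 nl].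
rewrite /can_add cn m0 n0 /=; apply/andP; split.
  case: eqP => //= m1.
  have : (m.-1, n) \in (m, n) :: D.
    rewrite -e mem_cells n0 /=.
    have := sortedP 0%N so m.-2; rewrite prednK; last lia.
    by move=> /(_ ltac:(lia)); rewrite /geq /=; lia.
  by rewrite inE xpair_eqE; case: eqP => //; lia.
case: eqP => //= n1.
have : (m, n.-1) \in (m, n) :: D by rewrite -e mem_cells m0 ms /=; lia.
by rewrite inE xpair_eqE andbC; case: eqP => //; lia.
Qed.

Lemma mem_addable D c : standard D -> (c \in addable_cells D) = can_add D c.
Proof.
move=> sD; apply/idP/idP => [/mem_addable_cells/(can_addP c sD)//|].
by move=> /(can_addP c sD)/mem_addable_cells.
Qed.

Lemma addable_uniq D : uniq (addable_cells D).
Proof.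
rewrite filter_uniq // allpairs_uniq ?iota_uniq //.
by move=> [a b] [a' b'] _ _ /= ->.
Qed.

Section Contents.
Variables (F : fieldType) (v : F).
Hypotheses (v0 : v != 0) (v_generic : forall n, (0 < n)%N -> v ^+ n != 1).

(** Contents are powers of one element that is not a root of unity, so
    equality of contents is equality of diagonals. *)
Lemma contentE c : content v c = (v ^- 2) ^ diagonal c.
Proof.
rewrite /content -[v ^- 2]/(v ^ (-2%:Z)) exprz_exp; congr (v ^ _).
by rewrite /diagonal; ring.
Qed.

Lemma step_neq0 : v ^- 2 != 0. Proof. by rewrite invr_eq0 expf_neq0. Qed.

Lemma step_inj (i j : int) : (v ^- 2) ^ i = (v ^- 2) ^ j -> i = j.
Proof.
wlog lij : i j / (i <= j)%R.
  by move=> H e; case: (lerP i j) => [/H->//|/ltW/H->].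
move=> /eqP; rewrite -subr_eq0.
have -> : j = i + `|j - i|%N%:Z by lia.
rewrite expfzDr ?step_neq0 // -{1}[_ ^ i]mulr1 -mulrBr mulf_eq0.
rewrite expfz_eq0 (negPf step_neq0) andbF /= subr_eq0 eq_sym -exprnP exprVn.
case: (posnP `|j - i|%N) => [->|n0]; first by rewrite addr0.
rewrite -exprM invr_eq1 => /eqP e.
by have := @v_generic (2 * `|j - i|)%N; rewrite e eqxx => /(_ ltac:(lia)).
Qed.

Lemma content_inj c c' : content v c = content v c' -> diagonal c = diagonal c'.
Proof. by rewrite !contentE => /step_inj. Qed.

End Contents.

(** * The spectrum of the next Jucys-Murphy element *)

Section WeightSwap.
Variables (C : comNzRingType) (B : algType C) (q : C) (k : nat) (s : nat -> B).
Hypothesis hs : hecke_generators q k s.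
Local Notation y := (jm s).

Lemma exchange_comm (z : B) i a b w : GRing.comm z (s i) ->
  z * exchange q s i a b w = exchange q s i a b (z * w).
Proof.
by move=> c; rewrite /exchange mulrDr -!scalerAr !mulrA c.
Qed.

Lemma exchange_weight xs i a b w : (size xs < i)%N -> (i < k)%N ->
  weight s xs w -> weight s xs (exchange q s i a b w).
Proof.
move=> xi ik ww.
have -> : exchange q s i a b w = ((a - b) *: s i + (q * b)%:A) * w.
  by rewrite mulrDl -scalerAl mulr_algl.
apply: weight_mull ww => j j0 jx; apply/commr_sym/commrD.
  rewrite /GRing.comm -scalerAl -scalerAr; congr (_ *: _).
  apply/commr_sym/(gen_jm_comm_lt hs) => //; lia.
by rewrite /GRing.comm mulr_algl mulr_algr.
Qed.

Lemma weight_swap pre a b xs w : (size pre + size xs + 2 <= k)%N ->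
  weight s (pre ++ b :: a :: xs) w ->
  weight s (pre ++ a :: b :: xs) (exchange q s (size xs).+1 a b w).
Proof.
elim: pre => [|c pre IHpre] /= xk; last first.
  case=> ww e; split; first by apply: IHpre => //; lia.
  move: e; rewrite !size_cat /= => e; 
  rewrite exchange_comm; last first.
    by apply/commr_sym; apply: (gen_jm_comm hs); lia.
  by rewrite e /exchange -scalerAr scalerDr !scalerA ![c * _]mulrC.
case=> -[ww ea] eb; split; last by apply: (exchange_upper hs) => //; lia.
by split; [apply: exchange_weight => //; lia | apply: (exchange_lower hs) => //; lia].
Qed.

Lemma intertwinerE i a x : intertwiner q s i a x =
  (s i * (a%:A - y i.+1) + q *: y i.+1) * x.
Proof. by rewrite /intertwiner mulrDl -scalerAl -mulrA mulrBl mulr_algl. Qed.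

Lemma intertwiner_weight xs i a x : (size xs < i)%N -> (i < k)%N ->
  weight s xs x -> weight s xs (intertwiner q s i a x).
Proof.
move=> xi ik ww.
rewrite intertwinerE; apply: weight_mull ww => j j0 jx.
have cs : GRing.comm (jm s j) (s i) by apply/commr_sym/(gen_jm_comm_lt hs) => //; lia.
have cy : GRing.comm (jm s j) (y i.+1) by apply: (jm_comm hs); lia.
apply/commr_sym/commrD.
  apply: commrM => //; apply: commrB => //.
  by rewrite /GRing.comm mulr_algl mulr_algr.
by rewrite /GRing.comm -scalerAl -scalerAr cy.
Qed.

Lemma intertwiner_root_prod cs i a x : (0 < i)%N -> (i < k)%N -> y i * x = a *: x ->
  root_prod (y i) cs * intertwiner q s i a x =
  intertwiner q s i a (root_prod (y i.+1) cs * x).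
Proof.
move=> i0 ik ea; elim: cs => [|c cs IHcs]; first by rewrite /root_prod !big_nil !mul1r.
rewrite !root_prod_cons -!mulrA IHcs; set z := _ * x.
have ez : y i * z = a *: z.
  rewrite mulrA root_prod_comm; last by apply: (jm_comm hs); lia.
  by rewrite -mulrA ea -scalerAr.
rewrite !mulrBl (intertwinerP hs) // !mulr_algl !intertwinerE.
by rewrite [RHS]mulrBr -scalerAr.
Qed.

End WeightSwap.

Lemma standard_catr l D : standard (l ++ D) -> standard D.
Proof. by elim: l => //= c l IHl /andP[/IHl]. Qed.

Section Spectrum.
Variables (F : fieldType) (v : F) (A : algType F) (k : nat) (s : nat -> A).
Hypotheses (v0 : v != 0) (v_generic : forall n, (0 < n)%N -> v ^+ n != 1).
Local Notation q := (v^-1 - v).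
Hypothesis hs : hecke_generators q k s.
Local Notation y := (jm s).
Local Notation cont := (map (content v)).

(** The property of D that the induction on the tableau establishes: on
    vectors of the weight of D, the next Jucys-Murphy element is annihilated
    by the product over the addable cells. The contents being distinct, it
    acts semisimply. *)
Definition spectral D := forall x, weight s (cont D) x ->
  root_prod (y (size D).+1) (cont (addable_cells D)) * x = 0.

Lemma eigenvalue_addable D b z : standard D -> spectral D ->
  weight s (cont D) z -> y (size D).+1 * z = b *: z ->
  (forall c, can_add D c -> content v c != b) -> z = 0.
Proof.
move=> sD QD wz e nb; have := QD z wz; rewrite (root_prod_eigen _ e).
move/eqP; rewrite scaler_eq0 => /orP[|/eqP//]; apply: contraTeq => _.
rewrite big_map prodf_seq_neq0; apply/allP => c; rewrite mem_addable //= => ac.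
by rewrite subr_eq0 eq_sym nb.
Qed.

Definition neighbours (c c' : cell) : Prop :=
  diagonal c' = diagonal c + 1 \/ diagonal c = diagonal c' + 1.

Lemma eigenvalue_neighbour D c c' z : standard D -> spectral D ->
  can_add D c -> neighbours c c' -> weight s (cont D) z ->
  y (size D).+1 * z = content v c' *: z -> z = 0.
Proof.
move=> sD QD ac nb wz e; apply: (eigenvalue_addable sD QD wz e) => d ad.
apply/eqP => /(content_inj v0 v_generic) ed.
have [ec|nc] := eqVneq c d; first by case: nb; rewrite ec; lia.
by case: (can_add_gap sD ac ad nc); case: nb; lia.
Qed.

Lemma content_neq0 c : content v c != 0.
Proof. by rewrite contentE // expfz_neq0 ?step_neq0. Qed.

Lemma q_neq0 : q != 0.
Proof.
rewrite subr_eq0; apply/eqP => e; have := v_generic (isT : 0 < 2)%N.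
by rewrite expr2 -{1}e mulVf // eqxx.
Qed.

Lemma sqr_v_neqN1 : v ^+ 2 + 1 != 0.
Proof.
apply/eqP => e; have := v_generic (isT : 0 < 4)%N; have -> : v ^+ 4 = 1; last by rewrite eqxx.
have -> : v ^+ 4 = (v ^+ 2 + 1) * (v ^+ 2 - 1) + 1 by ring.
by rewrite e mul0r add0r.
Qed.

Lemma content_neighbour c c' : diagonal c' = diagonal c + 1 ->
  content v c' = v ^- 2 * content v c.
Proof.
by move=> e; rewrite !contentE // e expfzDr ?step_neq0 // expr1z mulrC.
Qed.

Lemma neighbours_add c c' : neighbours c c' -> content v c + content v c' != 0.
Proof.
wlog e : c c' / diagonal c' = diagonal c + 1.
  move=> H [] e; first by apply: H => //; left.
  by rewrite addrC; apply: H => //; left.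
move=> _; rewrite (content_neighbour e) -{1}[content v c]mul1r -mulrDl.
rewrite mulf_neq0 ?content_neq0 //.
have -> : 1 + v ^- 2 = v ^- 2 * (v ^+ 2 + 1) by field.
by rewrite mulf_neq0 ?step_neq0 ?sqr_v_neqN1.
Qed.

Lemma neighbours_neq c c' : neighbours c c' -> content v c != content v c'.
Proof. by move=> nb; apply/eqP => /(content_inj v0 v_generic) e; case: nb; lia. Qed.

(** Both exchanges vanish, so s_i and s_(i+1) act on w by scalars c and d. The
    braid relation gives c d (c - d) = 0, while c d (c - d) is a multiple of a
    b (a + b). *)
Lemma braid_pattern i a b w : (0 < i)%N -> (i.+1 < k)%N ->
  a != 0 -> b != 0 -> a != b -> a + b != 0 ->
  exchange q s i a b w = 0 -> exchange q s i.+1 b a w = 0 -> w = 0.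
Proof.
move=> i0 ik a0 b0 ab ab0 e1 e2.
have ab' : a - b != 0 by rewrite subr_eq0.
have s1 : s i * w = (- (q * b) / (a - b)) *: w.
  apply: (scalerI ab'); rewrite scalerA mulrCA mulfV // mulr1.
  by apply/eqP; rewrite scaleNr -addr_eq0 -[X in X == _]/(exchange q s i a b w) e1.
have s2 : s i.+1 * w = (q * a / (a - b)) *: w.
  apply: (scalerI ab'); rewrite scalerA mulrCA mulfV // mulr1.
  apply/eqP; rewrite -subr_eq0 -oppr_eq0 opprB addrC -scaleNr opprB.
  by rewrite -[X in X == _]/(exchange q s i.+1 b a w) e2.
have := congr1 (fun z => z * w) (gen_braid hs i0 ik) => /=.
rewrite -!mulrA s1 -?scalerAr s2 -?scalerAr s1 -?scalerAr s2 !scalerA.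
move/eqP; rewrite -subr_eq0 -scalerBl scaler_eq0 => /orP[|/eqP//].
set c := (X in X == 0); suff -> : c = q ^+ 3 * a * b * (a + b) / (a - b) ^+ 3.
  by rewrite !mulf_eq0 invr_eq0 !expf_eq0 /= (negPf q_neq0) (negPf a0) (negPf b0)
    (negPf ab0) (negPf ab').
by rewrite /c; field; rewrite ab'.
Qed.


(** The cell g is a corner of the diagram without the last cell b, and the two
    contents are adjacent. Exchanging g with the cells added between g and b,
    none of which is adjacent to g, moves g next to b. The contents of g, b
    and the new eigenvalue then form the pattern excluded by [braid_pattern];
    both exchanges vanish there because a content adjacent to that of an
    addable cell is not an eigenvalue. *)
Lemma blocked_weight pre g V b w :
  standard (b :: pre ++ g :: V) -> ((size pre + size V).+2 < k)%N ->
  (forall D, standard D -> (size D <= (size pre + size V).+1)%N -> spectral D) ->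
  neighbours b g ->
  (g.1.+1, g.2) \notin pre ++ g :: V -> (g.1, g.2.+1) \notin pre ++ g :: V ->
  weight s (cont (b :: pre ++ g :: V)) w ->
  y (size pre + size V).+3 * w = content v g *: w -> w = 0.
Proof.
elim/last_ind: pre V w => [|pre c IHpre] V w.
  rewrite add0n => sD Vk IH nb _ _.
  rewrite /= size_map => -[[wV eg] eb] er.
  have /andP[/andP[sV ag] ab] : standard V && can_add V g && can_add (g :: V) b.
    by move: sD.
  have nb' : neighbours g b by case: nb; [right | left].
  have V1k : ((size V).+1 < k)%N by lia.
  (* a nonzero exchange would make the content of b, adjacent to the addable g,
     an eigenvalue after V; the same holds for e2 with g after b *)
  have e1 : exchange q s (size V).+1 (content v g) (content v b) w = 0.
    apply: (eigenvalue_neighbour sV _ ag nb').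
    - by apply: IH => //; lia.
    - by apply: (exchange_weight hs); rewrite ?size_map.
    by apply: (exchange_lower hs) => //; lia.
  have e2 : exchange q s (size V).+2 (content v b) (content v g) w = 0.
    apply: (@eigenvalue_neighbour (g :: V) b g) => //.
    - by rewrite /= sV.
    - by apply: IH; rewrite //= sV.
    - by apply: (exchange_weight hs); rewrite /= ?size_map.
    by apply: (exchange_lower hs) => //; lia.
  apply: braid_pattern e1 e2; rewrite ?content_neq0 ?neighbours_neq ?neighbours_add //.
rewrite size_rcons cat_rcons => sD Vk IH nb n1 n2 ww er.
have cV : c \in pre ++ c :: g :: V by rewrite mem_cat mem_head orbT.
have ne1 : c != (g.1.+1, g.2) by apply: contraNneq n1 => <-.
have ne2 : c != (g.1, g.2.+1) by apply: contraNneq n2 => <-.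
have scg : standard (c :: g :: V).
  by apply: (@standard_catr (b :: pre)).
have sgc : standard (g :: c :: V) by exact: standard_swap.
have e : c :: g :: V =i g :: c :: V by move=> z; rewrite !inE orbCA.
have [sV ag ac] : [/\ standard V, can_add V g & can_add V c].
  by move: scg sgc => /= /andP[/andP[-> ->] _] /andP[/andP[_ ->] _].
have ncg : c != g by move: scg => /= /andP[_ /and5P[]]; rewrite inE negb_or => /andP[].
have : exchange q s (size V).+1 (content v g) (content v c) w = 0.
  have szE : ((size pre).+1 + size V = size pre + (size V).+1)%N by rewrite addnS.
  apply: (IHpre (c :: V)).
  - exact: (standard_cat_eq (pre := b :: pre) e sgc).
  - by rewrite /= -szE.
  - by rewrite /= -szE.
  - by [].
  - by move: n1; rewrite !mem_cat e.
  - by move: n2; rewrite !mem_cat e.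
  - move: ww; rewrite -!cat_cons !map_cat !map_cons -(size_map (content v) V) => ww.
    apply: (weight_swap hs) ww; rewrite /= !size_map; clear -Vk; lia.
  rewrite /= -szE exchange_comm ?er.
    by rewrite /exchange -scalerAr scalerDr !scalerA ![content v g * _]mulrC.
  by apply/commr_sym; apply: (gen_jm_comm hs); clear -Vk; lia.
have gap := can_add_gap sV ac ag ncg.
(* the exchanged vector vanishes; exchanging back recovers a multiple of w,
   nonzero because g and c are both addable to V *)
move/(congr1 (exchange q s (size V).+1 (content v c) (content v g))).
have V1k : ((size V).+1 < k)%N by clear -Vk; lia.
rewrite (exchange_twice hs) // /exchange mulr0 !scaler0 addr0.
move/eqP; rewrite scaler_eq0 => /orP[|/eqP//].
have -> : q ^+ 2 * content v g * content v c - (content v g - content v c) ^+ 2 =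
  - ((content v g - v ^- 2 * content v c) * (content v g - v ^+ 2 * content v c)).
  by field.
rewrite oppr_eq0 mulf_eq0 !subr_eq0 => /orP[] /eqP ec.
  have : diagonal g = diagonal c + 1.
    by apply: (step_inj v0 v_generic); rewrite expfzDr ?step_neq0 // expr1z -!contentE // ec mulrC.
  by case: gap; clear; lia.
have : diagonal c = diagonal g + 1.
  apply: (step_inj v0 v_generic); rewrite expfzDr ?step_neq0 // expr1z -!contentE // ec.
  by field.
by case: gap; clear; lia.
Qed.

(** If y_r and y_(r+1) both had the eigenvalue a on w, then (y_r - a) s_r w
    would be a nonzero multiple of w, and y_r would not act semisimply on s_r
    w, against the hypothesis on D. *)
Lemma eigenvalue_repeat D b w : standard (b :: D) -> spectral D ->
  ((size D).+1 < k)%N -> weight s (cont (b :: D)) w ->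
  y (size D).+2 * w = content v b *: w -> w = 0.
Proof.
move=> /andP[sD ab] QD Dk [ww]; rewrite /= size_map => eb er.
have := QD (s (size D).+1 * w) (weight_gen hs _ Dk ww); rewrite size_map => /(_ (leqnn _)).
have bin : b \in addable_cells D by rewrite mem_addable.
rewrite (root_prod_perm _ (perm_map (content v) (perm_to_rem bin))) /=.
rewrite root_prod_cons -[_%:A]/(content v b *: 1) root_prodC1 -mulrA.
rewrite mulrBl (jm_gen_eigen hs _ _ eb er) // mulr_algl addrAC subrr add0r mulrN.
rewrite -scalerAr (root_prod_eigen _ eb) scalerA => /eqP.
rewrite oppr_eq0 scaler_eq0 => /orP[|/eqP//].
rewrite !mulf_eq0 (negPf q_neq0) (negPf (content_neq0 _)) /= big_map.
apply: contraTeq => _; rewrite prodf_seq_neq0; apply/allP => c /=.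
rewrite (mem_rem_uniq _ (addable_uniq D)) !inE mem_addable // => /andP[cb ac].
rewrite subr_eq0; apply/eqP => /(content_inj v0 v_generic).
by case: (can_add_gap sD ac ab cb); lia.
Qed.

(** The intertwiner carries polynomials in y_(r+1) to polynomials in y_r,
    whose spectrum is known from D; its square accounts for the two roots
    adjacent to the content of b. *)
Lemma candidate_spectrum b D x : standard D -> spectral D ->
  ((size D).+1 < k)%N -> weight s (cont (b :: D)) x ->
  root_prod (y (size D).+2) ((v ^+ 2 * content v b) :: (v ^- 2 * content v b)
     :: cont (addable_cells D)) * x = 0.
Proof.
move=> sD QD Dk [ww]; rewrite /= size_map => eb.
set i := (size D).+1; set a := content v b; set z := root_prod (y i.+1) (cont (addable_cells D)) * x.
have i0 : (0 < i)%N by []. 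
have ez : y i * z = a *: z.
  rewrite mulrA (root_prod_comm _ (jm_comm hs _ _)); try lia.
  by rewrite -mulrA eb -scalerAr.
have : intertwiner q s i a z = 0.
  rewrite -(intertwiner_root_prod hs) // QD //.
  by apply: (intertwiner_weight hs); rewrite ?size_map.
move/(intertwiner_eq0 hs i0 Dk ez) => e.
rewrite !root_prod_cons -!mulrA -/z -[RHS]e !mulrBl mulrBr !mulr_algl.
rewrite -scalerAr scalerBr scalerA opprB addrA [LHS](AC (3*1) (4*((2*3)*1))) /=.
rewrite [LHS](AC (1*(2*1)) ((3*(1*2))*4)) /= -opprD -scalerDl.
by congr (_ *: _ - _ *: _ + _); field.
Qed.

(** Among the candidates, the content of b is excluded by [eigenvalue_repeat].
    The content just below b which is not addable is also that of the cell to
    the left of b, and the one just to the right of b is that of the cell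
    above; these are excluded by [blocked_weight]. *)
Lemma spectrum D : standard D -> (size D < k)%N -> spectral D.
Proof.
have [n] := ubnP (size D); elim: n D => // n IHn [|b D] Dn sD Dk x wx.
  have e : y 1 * x = 1 *: x by rewrite mul1r scale1r.
  rewrite (root_prod_eigen _ e) big_map (big_rem (1, 1)%N) /=; last first.
    by rewrite mem_addable.
  by rewrite contentE [diagonal _](_ : _ = 0) // expr0z subrr mul0r scale0r.
have /andP[sD' ab] : standard D && can_add D b by [].
have IH D' : standard D' -> (size D' <= size D)%N -> spectral D'.
  by move=> sD1 sz; apply: IHn => //; move: Dn Dk => /=; lia.
have uD := standard_uniq sD.
have QD := IH D sD' (leqnn _).
have b12 : (0 < b.1)%N && (0 < b.2)%N by case/and5P: ab => _ -> ->.
have eup : content v (b.1.-1, b.2) = v ^- 2 * content v b.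
  by rewrite (@content_neighbour b) // /diagonal /=; lia.
have eleft : content v (b.1, b.2.-1) = v ^+ 2 * content v b.
  rewrite [content v b](@content_neighbour (b.1, b.2.-1)).
    by rewrite mulrA mulfV ?mul1r // expf_neq0.
  by rewrite /diagonal /=; lia.
have ebelow : content v (b.1.+1, b.2) = v ^+ 2 * content v b.
  rewrite [content v b](@content_neighbour (b.1.+1, b.2)).
    by rewrite mulrA mulfV ?mul1r // expf_neq0.
  by rewrite /diagonal /=; clear; lia.
have eright : content v (b.1, b.2.+1) = v ^- 2 * content v b.
  by rewrite (@content_neighbour b) // /diagonal /=; clear; lia.
have bD : b \notin D by case/and5P: ab.
have nbelow : (b.1.+1, b.2) \notin D.
  apply: contraNN bD => h; rewrite [b]surjective_pairing.
  by apply: (standard_lower sD' h); clear -b12; lia.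
have nright : (b.1, b.2.+1) \notin D.
  apply: contraNN bD => h; rewrite [b]surjective_pairing.
  by apply: (standard_lower sD' h); clear -b12; lia.
have below_addable : (b.2 == 1%N) || ((b.1.+1, b.2.-1) \in b :: D) ->
    can_add (b :: D) (b.1.+1, b.2).
  move=> h; apply/and5P; rewrite /= -surjective_pairing mem_head orbT; split=> //.
    by rewrite inE negb_or nbelow andbT; apply/eqP => /(congr1 fst) /=; clear; lia.
  by case/andP: b12.
have right_addable : (b.1 == 1%N) || ((b.1.-1, b.2.+1) \in b :: D) ->
    can_add (b :: D) (b.1, b.2.+1).
  move=> h; apply/and5P; rewrite /= -surjective_pairing mem_head orbT; split=> //.
    by rewrite inE negb_or nright andbT; apply/eqP => /(congr1 snd) /=; clear; lia.
  by case/andP: b12.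
apply: (root_prod_shrink (M := weight s (cont (b :: D))) _ _ wx _ (candidate_spectrum sD' QD Dk wx)).
- move=> c z wz; apply: weight_mull wz => j j0 jx.
  have jk : (j <= k)%N by move: jx Dk; rewrite /= size_map; clear; lia.
  apply/commr_sym/commrB; first exact: (jm_comm hs).
  by rewrite /GRing.comm mulr_algl mulr_algr.
- move=> c z cin ncin wz ez.
  have nadd d : can_add (b :: D) d -> c <> content v d.
    by move=> ad ec; case/mapP: ncin; exists d; rewrite ?mem_addable.
  have up_or_left g : neighbours b g -> g \in D -> content v g = c ->
      (g.1.+1, g.2) \notin D -> (g.1, g.2.+1) \notin D -> z = 0.
    move=> nb gD ec n1 n2; rewrite -ec in ez.
    case/path.splitPr: gD sD Dk wz ez n1 n2 IH => pre V sD1 Dk wz ez n1 n2 IH.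
    have szE : size (pre ++ g :: V) = (size pre + size V).+1 by rewrite size_cat addnS.
    by apply: (blocked_weight sD1 _ _ nb n1 n2 wz); rewrite -?szE.
  move: cin; rewrite !inE => /or3P[/eqP ec|/eqP ec|/mapP[d]].
  + apply: (up_or_left (b.1, b.2.-1)); rewrite ?eleft //=.
    * by right; rewrite /diagonal /=; clear -b12; lia.
    * case/and5P: ab => _ _ _ _ /orP[/eqP b21|//]; case: (nadd (b.1.+1, b.2)).
        by apply: below_addable; rewrite b21.
      by rewrite ec -ebelow.
    * apply/negP => h; case: (nadd (b.1.+1, b.2)); last by rewrite ec -ebelow.
      by apply: below_addable; rewrite inE h !orbT.
    * by rewrite prednK; [case/and5P: ab; case: (b) | clear -b12; lia].
  + apply: (up_or_left (b.1.-1, b.2)); rewrite ?eup //=.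
    * by left; rewrite /diagonal /=; clear -b12; lia.
    * case/and5P: ab => _ _ _ /orP[/eqP b11|//] _; case: (nadd (b.1, b.2.+1)).
        by apply: right_addable; rewrite b11.
      by rewrite ec -eright.
    * by rewrite prednK; [case/and5P: ab; case: (b) | clear -b12; lia].
    * apply/negP => h; case: (nadd (b.1, b.2.+1)); last by rewrite ec -eright.
      by apply: right_addable; rewrite inE h !orbT.
  rewrite mem_addable // => ad ec; have [db|ndb] := eqVneq d b.
    by apply: (eigenvalue_repeat sD QD Dk wz); rewrite -db -ec.
  by case: (nadd d) => //; apply: can_add_cons.
have cu : uniq (cont (addable_cells D)).
  rewrite map_inj_in_uniq ?addable_uniq // => c d; rewrite !mem_addable // => ac ad.
  move=> /(content_inj v0 v_generic) e; apply/eqP; apply: contraT => ne.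
  by case: (can_add_gap sD' ac ad ne); rewrite e; clear; lia.
have far g : neighbours b g -> content v g \notin cont (addable_cells D).
  move=> nb; apply/negP => /mapP[d]; rewrite mem_addable // => ad.
  move=> /(content_inj v0 v_generic) e; have [db|ndb] := eqVneq d b.
    by case: nb; rewrite e db; clear; lia.
  by case: (can_add_gap sD' ad ab ndb); case: nb; rewrite e; clear; lia.
rewrite /= cu andbT inE negb_or -eleft -eup !far; last 2 first.
- by left; rewrite /diagonal /=; clear -b12; lia.
- by right; rewrite /diagonal /=; clear -b12; lia.
rewrite !andbT; apply/eqP => /(content_inj v0 v_generic).
by rewrite /diagonal /=; clear -b12; lia.
Qed.

End Spectrum.

(** * Telescoping of contents and the quotient of hook products *)

Section NewCell.
Variables (D : seq cell) (i j : nat).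
Hypotheses (sD : standard D) (aD : can_add D (i, j)).

Lemma new_cell_pos : (0 < i)%N && (0 < j)%N.
Proof. by case/and5P: aD => _ -> ->. Qed.

Lemma new_cell_row : row_len D i = j.-1.
Proof.
have /andP[i0 j0] := new_cell_pos.
case/and5P: aD; rewrite !mem_row_len //= i0 j0 /= -ltnNge => lt _ _ _ h.
by move: h lt j0; case: eqP => [->|] /=; lia.
Qed.

Lemma new_cell_col : col_len D j = i.-1.
Proof.
have /andP[i0 j0] := new_cell_pos.
case/and5P: aD; rewrite !mem_col_len //= i0 j0 /= -ltnNge => lt _ _ h _.
by move: h lt i0; case: eqP => [->|] /=; lia.
Qed.

Lemma row_above r : (0 < r)%N -> (r < i)%N -> (j <= row_len D r)%N.
Proof.
move=> r0 ri; have /andP[i0 j0] := new_cell_pos.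
case/and5P: aD => _ _ _ /= /orP[/eqP|h _]; first by move: ri r0; clear; lia.
have : (r, j) \in D by apply: (standard_lower sD h); move: r0 ri j0; clear; lia.
by rewrite mem_row_len // => /and3P[].
Qed.

Lemma col_left s : (0 < s)%N -> (s < j)%N -> (i <= col_len D s)%N.
Proof.
move=> r0 ri; have /andP[i0 j0] := new_cell_pos.
case/and5P: aD => _ _ _ /= _ /orP[/eqP|h]; first by move: ri r0; clear; lia.
have : (i, s) \in D by apply: (standard_lower sD h); move: r0 ri i0; clear; lia.
by rewrite mem_col_len // => /and3P[].
Qed.

(** Rows above the new cell, then the columns to its left below those rows.
    This is the splitting in which the contents telescope without reference to
    removable corners. *)
Lemma diagram_split : perm_eq D
  ([seq (r, n) | r <- index_iota 1 i, n <- index_iota 1 (row_len D r).+1] ++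
   [seq (r, s) | s <- index_iota 1 j, r <- index_iota i (col_len D s).+1]).
Proof.
have /andP[i0 j0] := new_cell_pos.
apply: uniq_perm; first exact: standard_uniq.
  rewrite cat_uniq !allpairs_uniq_dep ?iota_uniq //.
  - rewrite andbT; apply/hasPn => _ /allpairsPdep[s [r [_ + ->]]].
    rewrite mem_index_iota => /andP[ir _]; apply/negP => /allpairsPdep[r' [n' [+ _]]].
    by rewrite mem_index_iota => + [e _]; move: ir; rewrite e; clear; lia.
  - by move=> *; apply: iota_uniq.
  - by move=> [? ?] [? ?] _ _ /= [-> ->].
  - by move=> *; apply: iota_uniq.
  - by move=> [? ?] [? ?] _ _ /= [-> ->].
move=> [m n]; rewrite mem_cat; apply/idP/orP => [h|].
  have [mi|im] := ltnP m i.
    left; apply/allpairsPdep; exists m, n; rewrite !mem_index_iota.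
    move: h; rewrite mem_row_len // => /and3P[m0 n0 nr]; split=> //.
      by rewrite m0.
    by rewrite n0.
  right; apply/allpairsPdep; exists n, m; rewrite !mem_index_iota.
  have [m0 n0] := andP (standard_pos sD h).
  have nj : (n < j)%N.
    rewrite ltnNge; apply/negP => jn; case/and5P: aD => /negP[].
    by apply: (standard_lower sD h); rewrite ?i0 ?j0.
  by move: h; rewrite mem_col_len // => /and3P[_ _ mc]; rewrite n0 nj im ltnS mc.
case=> /allpairsPdep[a [b []]]; rewrite !mem_index_iota.
  by move=> ha hb [-> ->]; rewrite mem_row_len //; move: ha hb; clear; lia.
by move=> ha hb [-> ->]; rewrite mem_col_len //; move: ha hb i0; clear; lia.
Qed.

Lemma new_cell_row_perm : perm_eq [seq a <- D | a.1 == i] [seq (i, s) | s <- index_iota 1 j].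
Proof.
have /andP[i0 j0] := new_cell_pos.
apply: uniq_perm; first by rewrite filter_uniq ?standard_uniq.
  by rewrite map_inj_uniq ?iota_uniq // => ? ? [].
move=> [m n]; rewrite mem_filter /=; apply/andP/mapP.
  case=> /eqP-> h; exists n => //; move: h.
  by rewrite mem_row_len // new_cell_row mem_index_iota; move: j0; clear; lia.
case=> s; rewrite mem_index_iota => hs [-> ->]; rewrite mem_row_len // new_cell_row eqxx.
by split=> //; move: hs i0 j0; clear; lia.
Qed.

Lemma new_cell_col_perm : perm_eq [seq a <- D | a.2 == j] [seq (r, j) | r <- index_iota 1 i].
Proof.
have /andP[i0 j0] := new_cell_pos.
apply: uniq_perm; first by rewrite filter_uniq ?standard_uniq.
  by rewrite map_inj_uniq ?iota_uniq // => ? ? [].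
move=> [m n]; rewrite mem_filter /=; apply/andP/mapP.
  case=> /eqP-> h; exists m => //; move: h.
  by rewrite mem_col_len // new_cell_col mem_index_iota; move: i0; clear; lia.
case=> s; rewrite mem_index_iota => hs [-> ->]; rewrite mem_col_len // new_cell_col eqxx.
by split=> //; move: hs i0 j0; clear; lia.
Qed.

Section Telescope.
Variables (K : fieldType) (l : int -> K).
Hypothesis l0 : forall e, l e != 0.

Let g (e : int) := l (e - 1) * l (e + 1) / l e ^+ 2.

Lemma telescope_up (a : int) (n : nat) :
  \prod_(1 <= m < n.+1) g (a + m%:Z) = l a / l (a + 1) * (l (a + n%:Z + 1) / l (a + n%:Z)).
Proof.
elim: n => [|n IHn].
  by rewrite big_geq // addr0; field; rewrite !l0.
rewrite big_nat_recr //= IHn /g.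
have -> : a + n.+1%:Z - 1 = a + n%:Z by lia.
have -> : a + n.+1%:Z = a + n%:Z + 1 by lia.
by field; rewrite !l0.
Qed.

Lemma telescope_down (a : int) (b n : nat) : (b <= n.+1)%N ->
  \prod_(b <= m < n.+1) g (a - m%:Z) =
  l (a - b%:Z + 1) / l (a - b%:Z) * (l (a - n%:Z - 1) / l (a - n%:Z)).
Proof.
rewrite leq_eqVlt => /orP[/eqP ->|].
  rewrite big_geq //.
  have -> : a - n.+1%:Z + 1 = a - n%:Z by lia.
  have -> : a - n.+1%:Z = a - n%:Z - 1 by lia.
  by field; rewrite !l0.
elim: n => [|n IHn]; rewrite ltnS leq_eqVlt => /orP[/eqP ->|lt] //.
- by rewrite big_nat1 /g; field; rewrite !l0.
- by rewrite big_nat1 /g; field; rewrite !l0.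
rewrite big_nat_recr /= ?IHn ?(ltnW lt) // /g.
have -> : a - n.+1%:Z + 1 = a - n%:Z by lia.
have -> : a - n%:Z - 1 = a - n.+1%:Z by lia.
by field; rewrite !l0.
Qed.

(** The boundary factors that [telescope_up] and [telescope_down] leave on the
    first column and on the row of the new cell cancel along these lines. *)
Lemma telescope_plain (h : nat -> K) (a b : nat) : (forall n, h n != 0) -> (a <= b)%N ->
  \prod_(a <= m < b) (h m.+1 / h m) = h b / h a.
Proof.
move=> h0; elim: b => [|b IHb]; rewrite leq_eqVlt => /orP[/eqP->|//].
- by rewrite big_geq // mulfV.
- by rewrite big_geq // mulfV.
by rewrite ltnS => ab; rewrite big_nat_recr //= IHb //; field; rewrite !h0.
Qed.

(** Read with l e = u - x^e, the left-hand side is the scalar of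
    [fusion_row_weight], and the factor l (j - i) on the right is the zero at
    the content of the new cell. *)
Lemma diagram_telescope :
  l 0 * \prod_(a <- D) g (diagonal a) =
  l (j%:Z - i%:Z) *
  (\prod_(1 <= r < i) (l ((row_len D r)%:Z - r%:Z + 1) / l ((row_len D r)%:Z - r%:Z)) *
   \prod_(1 <= s < j) (l (s%:Z - (col_len D s)%:Z - 1) / l (s%:Z - (col_len D s)%:Z))).
Proof.
have /andP[i0 j0] := new_cell_pos.
rewrite (perm_big _ diagram_split) /= big_cat /= !big_allpairs_dep /=.
rewrite (eq_big_seq (fun r => l (- r%:Z) / l (- r%:Z + 1) *
    (l ((row_len D r)%:Z - r%:Z + 1) / l ((row_len D r)%:Z - r%:Z)))); last first.
  move=> r _; rewrite [_%:Z - r%:Z]addrC -telescope_up.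
  by apply: eq_bigr => n _; rewrite /diagonal addrC.
rewrite big_split /=.
rewrite [X in _ * (_ * X)](eq_big_seq (fun s => l (s%:Z - i%:Z + 1) / l (s%:Z - i%:Z) *
    (l (s%:Z - (col_len D s)%:Z - 1) / l (s%:Z - (col_len D s)%:Z)))); last first.
  move=> s; rewrite mem_index_iota => /andP[s0 sj].
  by rewrite -telescope_down // ltnW // ltnS col_left.
rewrite [X in _ * (_ * X)]big_split /=.
have -> : \prod_(1 <= r < i) (l (- r%:Z) / l (- r%:Z + 1)) = l (1 - i%:Z) / l 0.
  have := @telescope_plain (fun n => l (1 - n%:Z)) 1 i (fun n => l0 _) i0.
  rewrite subrr => <-; apply: eq_bigr => r _; congr (l _ / l _); clear; lia.
have -> : \prod_(1 <= s < j) (l (s%:Z - i%:Z + 1) / l (s%:Z - i%:Z)) =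
    l (j%:Z - i%:Z) / l (1 - i%:Z).
  rewrite -(@telescope_plain (fun n => l (n%:Z - i%:Z)) 1 j (fun n => l0 _) j0).
  by apply: eq_bigr => r _; congr (l _ / l _); clear; lia.
by field; rewrite !l0.
Qed.

End Telescope.

Definition hook_length (E : seq cell) (a : cell) : nat :=
  (row_len E a.1 - a.2 + (col_len E a.2 - a.1)).+1.

(** The scalar f of a partition without its power of t. The exponents of x add
    up to half of b, whose double is absorbed in x = v^-2. *)
Definition hook_product (F : fieldType) (x : F) (E : seq cell) : F :=
  \prod_(a <- E) (x ^+ a.2.-1 * (1 - x) / (1 - x ^+ hook_length E a)).

Section HookRatio.
Variables (F : fieldType) (x : F).
Hypotheses (x_neq0 : x != 0) (x_generic : forall n, (0 < n)%N -> 1 - x ^+ n != 0).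

Lemma hook_row s : (0 < s)%N -> (s < j)%N ->
  hook_length D (i, s) = (j - s + (col_len D s - i))%N /\
  hook_length ((i, j) :: D) (i, s) = (j - s + (col_len D s - i)).+1.
Proof.
move=> s0 sj; have /andP[i0 j0] := new_cell_pos.
rewrite /hook_length /row_len /col_len /= eqxx.
have -> : (j == s) = false by apply/eqP; move: sj; clear; lia.
rewrite -/(row_len D i) -/(col_len D s) new_cell_row; move: sj j0; clear; lia.
Qed.

Lemma hook_col r : (0 < r)%N -> (r < i)%N ->
  hook_length D (r, j) = (i - r + (row_len D r - j))%N /\
  hook_length ((i, j) :: D) (r, j) = (i - r + (row_len D r - j)).+1.
Proof.
move=> r0 ri; have /andP[i0 j0] := new_cell_pos.
rewrite /hook_length /row_len /col_len /= eqxx.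
have -> : (i == r) = false by apply/eqP; move: ri; clear; lia.
rewrite -/(row_len D r) -/(col_len D j) new_cell_col; move: ri i0; clear; lia.
Qed.

Lemma hook_other a : a.1 != i -> a.2 != j ->
  hook_length ((i, j) :: D) a = hook_length D a.
Proof.
by move=> ai aj; rewrite /hook_length /row_len /col_len /= ![_ == a.1]eq_sym
  ![_ == a.2]eq_sym (negPf ai) (negPf aj).
Qed.

Lemma hook_new : hook_length ((i, j) :: D) (i, j) = 1%N.
Proof.
have /andP[i0 j0] := new_cell_pos.
rewrite /hook_length /row_len /col_len /= !eqxx.
rewrite -/(row_len D i) -/(col_len D j) new_cell_col new_cell_row.
by move: i0 j0; clear; lia.
Qed.

(** A new cell changes only the hooks in its row and in its column, each by
    one. *)
Lemma hook_product_ratio :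
  hook_product x D = hook_product x ((i, j) :: D) * x ^- j.-1 *
  (\prod_(1 <= r < i) ((1 - x ^+ (i - r + (row_len D r - j)).+1) /
                       (1 - x ^+ (i - r + (row_len D r - j)))) *
   \prod_(1 <= s < j) ((1 - x ^+ (j - s + (col_len D s - i)).+1) /
                       (1 - x ^+ (j - s + (col_len D s - i))))).
Proof.
have nz E a : 1 - x ^+ hook_length E a != 0 by exact: x_generic.
(* rho a differs from 1 only when a is in the row or the column of the new cell *)
pose rho a := (1 - x ^+ hook_length ((i, j) :: D) a) / (1 - x ^+ hook_length D a).
have x1 : 1 - x != 0 by have := x_generic (isT : 0 < 1)%N; rewrite expr1.
have -> : hook_product x D = hook_product x ((i, j) :: D) * x ^- j.-1 *
    \prod_(a <- D) rho a.
  rewrite /hook_product big_cons hook_new expr1 /=.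
  have -> : \prod_(a <- D) (x ^+ a.2.-1 * (1 - x) / (1 - x ^+ hook_length D a)) =
      \prod_(a <- D) (x ^+ a.2.-1 * (1 - x) /
        (1 - x ^+ hook_length ((i, j) :: D) a)) * \prod_(a <- D) rho a.
    rewrite -big_split /=; apply: eq_bigr => a _; rewrite /rho.
    by field; rewrite !nz.
  by field; rewrite expf_neq0 // x1.
congr (_ * _).
rewrite (bigID (fun a => a.2 == j)) /= -big_filter (perm_big _ new_cell_col_perm) big_map /=.
congr (_ * _).
  apply: eq_big_nat => r /andP[r0 ri].
  by rewrite /rho; have [-> ->] := hook_col r0 ri.
rewrite (bigID (fun a => a.1 == i)) /= [X in _ * X]big1 ?mulr1; last first.
  by move=> a /andP[aj ai]; rewrite /rho hook_other // divff.
rewrite -big_filter (_ : [seq a <- D | _] = [seq a <- D | a.1 == i]); last first.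
  apply: eq_in_filter => a ainD; case: (a.1 =P i) => [ai|]; last by rewrite andbF.
  rewrite andbT; apply/eqP => aj; case/and5P: aD => /negP[].
  by rewrite -ai -aj -surjective_pairing.
rewrite (perm_big _ new_cell_row_perm) big_map /=.
apply: eq_big_nat => s /andP[s0 sj].
by rewrite /rho; have [-> ->] := hook_row s0 sj.
Qed.

End HookRatio.
End NewCell.

Lemma quadratic_factor (R : comNzRingType) (X a b e : R) : e * e = a * b ->
  (X - e) ^+ 2 - (a + b - 2%:R * e) * X = (X - a) * (X - b).
Proof.
move=> ee; transitivity (X * X - (a + b) * X + e * e); first by ring.
by rewrite ee; ring.
Qed.

Lemma clear_denominators (K : fieldType) (a n m b m1 m2 d1 d2 : K) :
  m != 0 -> d1 != 0 -> d2 != 0 ->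
  a * (n / m) = b * (m1 / d1 * (m2 / d2)) -> a * n * (d1 * d2) = b * (m1 * m2) * m.
Proof.
move=> m0 d10 d20 e; transitivity (a * (n / m) * m * (d1 * d2)); first by field.
by rewrite e; field; rewrite ?m0 ?d10 ?d20.
Qed.

Section FusionScalar.
Variables (F : fieldType) (v : F).
Hypotheses (v0 : v != 0) (v_generic : forall n, (0 < n)%N -> v ^+ n != 1).
Local Notation q := (v^-1 - v).
Local Notation x := (v ^- 2).
Local Notation lin e := ('X - (x ^ e)%:P : {poly F}).

Lemma step_generic n : (0 < n)%N -> 1 - x ^+ n != 0.
Proof.
move=> n0; rewrite subr_eq0 eq_sym exprVn -exprM invr_eq1.
by apply: v_generic; rewrite muln_gt0.
Qed.

Lemma content_quadratic c :
  ('X - (content v c)%:P) ^+ 2 - (q ^+ 2 * content v c)%:P * 'X =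
  lin (diagonal c - 1) * lin (diagonal c + 1).
Proof.
have x0 := step_neq0 v0.
rewrite contentE; move: (diagonal c) => d; rewrite !expfzDr // expr1z.
have -> : x ^ (-1) = v ^+ 2 by rewrite exprN1 invrK.
move: (x ^ d) => e.
have ab : (e * v ^+ 2)%:P * (e * x)%:P = (e ^+ 2)%:P :> {poly F}.
  by rewrite -polyCM; congr _%:P; field.
have apb : (q ^+ 2 * e)%:P = (e * v ^+ 2)%:P + (e * x)%:P - 2%:R * e%:P :> {poly F}.
  rewrite -[2%:R]polyC_natr -polyCM -polyCD -polyCB; congr _%:P; field.
  by rewrite v0.
rewrite apb; apply: quadratic_factor.
by rewrite ab rmorphXn expr2.
Qed.

(** The polynomial identity is the telescoping of contents. At the content of
    the new cell the factors left over are those of the rows above and the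
    columns to the left, that is the hooks in the column and the row of the
    new cell. *)
Lemma fusion_scalar D c : standard D -> can_add D c ->
  exists num den : {poly F},
  [/\ ('X - 1) * \prod_(a <- D) (('X - (content v a)%:P) ^+ 2
          - (q ^+ 2 * content v a)%:P * 'X) * den =
       ('X - (content v c)%:P) * num * \prod_(a <- D) ('X - (content v a)%:P) ^+ 2,
     den.[content v c] != 0 &
     hook_product x (c :: D) * num.[content v c] = hook_product x D * den.[content v c]].
Proof.
case: c => i j sD aD; have /andP[i0 j0] := new_cell_pos aD.
have x0 := step_neq0 v0.
have xg := step_generic.
pose row r := (row_len D r)%:Z - r%:Z; pose col s := s%:Z - (col_len D s)%:Z.
exists (\prod_(1 <= r < i) lin (row r + 1) * \prod_(1 <= s < j) lin (col s - 1)).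
exists (\prod_(1 <= r < i) lin (row r) * \prod_(1 <= s < j) lin (col s)).
have ev e (u : F) : (lin e).[u] = u - x ^ e by rewrite hornerXsubC.
split.
- apply/eqP; rewrite -tofrac_eq; apply/eqP.
  pose l e : {fraction {poly F}} := tofrac (lin e).
  have l0 e : l e != 0 by rewrite tofrac_eq0 polyXsubC_eq0.
  have := diagram_telescope sD aD l0; rewrite !prodf_div => tel.
  rewrite contentE -[j%:Z - i%:Z]/(diagonal (i, j)) in tel *.
  rewrite !rmorphM !rmorph_prod /= -[tofrac ('X - (x ^ diagonal (i, j))%:P)]/(l _).
  have -> : tofrac ('X - 1) = l 0 by rewrite /l expr0z.
  rewrite (eq_bigr (fun a => l (diagonal a - 1) * l (diagonal a + 1))); last first.
    by move=> a _; rewrite content_quadratic rmorphM.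
  rewrite [X in _ = _ * X](eq_bigr (fun a => l (diagonal a) ^+ 2)); last first.
    by move=> a _; rewrite rmorphXn contentE.
  have nz (I : eqType) (r : seq I) (f : I -> int) : \prod_(a <- r) l (f a) != 0.
    by rewrite prodf_seq_neq0; apply/allP => a _; rewrite l0.
  have nz2 : \prod_(a <- D) l (diagonal a) ^+ 2 != 0.
    by rewrite prodf_seq_neq0; apply/allP => a _; rewrite expf_neq0 ?l0.
  set N := \prod_(a <- D) (l _ * l _) in tel *; set M := \prod_(a <- D) l _ ^+ 2 in tel nz2 *.
  have n1 := nz _ (index_iota 1 i) row; have n2 := nz _ (index_iota 1 j) col.
  rewrite /row /col in n1 n2 *.
  set d1 := \prod_(1 <= r < i) l ((row_len D r)%:Z - r%:Z) in tel n1.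
  set d2 := \prod_(1 <= s < j) l (s%:Z - (col_len D s)%:Z) in tel n2.
  set m1 := \prod_(1 <= r < i) l ((row_len D r)%:Z - r%:Z + 1) in tel.
  set m2 := \prod_(1 <= s < j) l (s%:Z - (col_len D s)%:Z - 1) in tel.
  rewrite -/d1 -/d2 -/m1 -/m2.
  exact: clear_denominators nz2 n1 n2 tel.
- rewrite hornerM !horner_prod mulf_neq0 //; rewrite prodf_seq_neq0; apply/allP => r;
    rewrite mem_index_iota => /andP[r0 rj] /=; rewrite ev contentE subr_eq0; apply/eqP.
    move/(step_inj v0 v_generic); rewrite /diagonal /row /=.
    by have := row_above sD aD r0 rj; move: rj; clear; lia.
  move/(step_inj v0 v_generic); rewrite /diagonal /col /=.
  by have := col_left sD aD r0 rj; move: rj; clear; lia.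
rewrite (hook_product_ratio sD aD x0 xg) !hornerM !horner_prod -!mulrA; congr (_ * _).
have rowE r : (0 < r)%N -> (r < i)%N ->
    (1 - x ^+ (i - r + (row_len D r - j)).+1) / (1 - x ^+ (i - r + (row_len D r - j)))
    * (lin (row r)).[content v (i, j)] = (lin (row r + 1)).[content v (i, j)].
  move=> r0 ri; rewrite !ev contentE.
  have := row_above sD aD r0 ri; set h := (i - r + _)%N => rj.
  have h0 : (0 < h)%N by rewrite /h; move: ri rj; clear; lia.
  have -> : row r + 1 = diagonal (i, j) + h.+1%:Z by rewrite /row /h /diagonal /=; move: ri rj; clear; lia.
  have -> : row r = diagonal (i, j) + h%:Z by rewrite /row /h /diagonal /=; move: ri rj; clear; lia.
  move: (diagonal (i, j)) => d; rewrite !expfzDr // -!exprnP; have := xg _ h0.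
  move: (x ^ d) => e nz; move: (xg _ (ltn0Sn h)); move: (x ^+ h.+1) => X' _; move: (x ^+ h) nz => X nz.
  by field.
have colE s : (0 < s)%N -> (s < j)%N ->
    (1 - x ^+ (j - s + (col_len D s - i)).+1) / (1 - x ^+ (j - s + (col_len D s - i)))
    * (lin (col s)).[content v (i, j)] = x * (lin (col s - 1)).[content v (i, j)].
  move=> s0 sj; rewrite !ev contentE.
  have := col_left sD aD s0 sj; set h := (j - s + _)%N => ci.
  have h0 : (0 < h)%N by rewrite /h; move: sj ci; clear; lia.
  have -> : diagonal (i, j) = col s + h%:Z by rewrite /col /h /diagonal /=; move: sj ci; clear; lia.
  move: (col s) => d; rewrite exprS !expfzDr // -exprnP exprN1; have := xg _ h0.
  move: (x ^ d) (x ^+ h) => e X nz; move: x x0 nz => y y0 nz.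
  by field; rewrite nz y0.
rewrite [X in _ = _ * X](AC (1*(1*(1*1))) ((1*3)*(2*4))) /= -!big_split /=.
rewrite [X in _ = _ * (X * _)](eq_big_nat _ _
    (F2 := fun r => (lin (row r + 1)).[content v (i, j)])); last first.
  by move=> r /andP[r0 ri]; exact: rowE.
rewrite [X in _ = _ * (_ * X)](eq_big_nat _ _
    (F2 := fun s => x * (lin (col s - 1)).[content v (i, j)])); last first.
  by move=> s /andP[s0 sj]; exact: colE.
rewrite big_split /= prodr_const_nat subn1 mulrCA mulKf //.
by rewrite expf_neq0.
Qed.

End FusionScalar.

(** * The pole of one fusion factor *)

Section FusionStep.
Variables (C : comNzRingType) (B : algType C) (q : C) (k : nat) (s : nat -> B).
Hypothesis hs : hecke_generators q k s.
Local Notation y := (jm s).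

(** The divided difference of the product over cs at u and Y; it commutes with
    whatever commutes with Y. *)
Lemma divided_difference (Y : B) (u : C) (cs : seq C) : exists Q : B,
  (u%:A - Y) * Q = (\prod_(c <- cs) (u - c))%:A - root_prod Y cs /\
  (forall z, GRing.comm z Y -> GRing.comm z Q).
Proof.
elim: cs => [|c cs [Q [eQ cQ]]].
  exists 0; split; last by move=> z _; exact: commr0.
  by rewrite mulr0 /root_prod !big_nil scale1r subrr.
exists ((\prod_(c <- cs) (u - c))%:A + (Y - c%:A) * Q); split; last first.
  move=> z zY; apply: commrD; first by rewrite /GRing.comm mulr_algl mulr_algr.
  apply: commrM; last exact: cQ.
  by apply: commrB => //; rewrite /GRing.comm mulr_algl mulr_algr.
have cm : GRing.comm (u%:A - Y) (Y - c%:A).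
  apply: commrB; last by rewrite /GRing.comm mulr_algl mulr_algr.
  by apply/commr_sym/commrB => //; rewrite /GRing.comm mulr_algl mulr_algr.
rewrite mulrDr mulrA cm -mulrA eQ root_prod_cons big_cons.
rewrite mulr_algr mulrBr mulr_algr addrA -scalerDr; congr (_ - _).
by rewrite addrA subrK -scalerBl scalerA mulrC.
Qed.

(** The vector on the right plays the role of (u - y) ^-1 E after
    multiplication by (u - sigma) times the product over cs: multiplying it by
    u - y gives back E with these factors. The scalar identity for fusion
    factors is applied to it. *)
Lemma fusion_row_pole (xs cs : seq C) (u sigma : C) (E Q : B) :
  (size xs < k)%N -> weight s xs E ->
  (u%:A - y (size xs).+1) * Q =
    (\prod_(c <- cs) (u - c))%:A - root_prod (y (size xs).+1) cs ->
  (forall z, GRing.comm z (y (size xs).+1) -> GRing.comm z Q) ->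
  root_prod (y (size xs).+1) (sigma :: cs) * E = 0 ->
  (\prod_(x <- xs) (u - x) * ((u - sigma) * \prod_(c <- cs) (u - c))) *:
     (fusion_row q s xs u * E) =
  ((u - 1) * \prod_(x <- xs) ((u - x) ^+ 2 - q ^+ 2 * x * u)) *:
     (((\prod_(c <- cs) (u - c))%:A + (y (size xs).+1 - sigma%:A) * Q) * E).
Proof.
move=> xk wE; set Y := y (size xs).+1 => eQ cQ RE; set P := \prod_(c <- cs) _; set Z := (_ + _) * E.
have cE i : (0 < i)%N -> (i <= size xs)%N -> GRing.comm (y i) Y.
  by move=> i0 ix; apply: (jm_comm hs); move: ix xk; clear; lia.
have wZ : weight s xs Z.
  apply: weight_mull wE => i i0 ix; apply/commr_sym/commrD.
    by rewrite /GRing.comm mulr_algl mulr_algr.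
  apply: commrM; last by apply: cQ; exact: cE.
  by apply: commrB; [exact: cE | rewrite /GRing.comm mulr_algl mulr_algr].
rewrite -(fusion_row_weight hs u xk wZ) -/Y -scalerA; congr (_ *: _).
rewrite scalerAr; congr (_ * _).
have -> : u *: Z - Y * Z = (u%:A - Y) * Z by rewrite mulrBl mulr_algl.
have cm : GRing.comm (u%:A - Y) (Y - sigma%:A).
  apply: commrB; last by rewrite /GRing.comm mulr_algl mulr_algr.
  by apply/commr_sym/commrB => //; rewrite /GRing.comm mulr_algl mulr_algr.
have -> : (u%:A - Y) * Z = ((u%:A - Y) * P%:A + (Y - sigma%:A) * P%:A
    - root_prod Y (sigma :: cs)) * E.
  rewrite /Z [LHS]mulrA; congr (_ * E).
  by rewrite [LHS]mulrDr [X in _ + X]mulrA cm -[X in _ + X]mulrA eQ -/P mulrBr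
    -root_prod_cons addrA.
rewrite [RHS]mulrBl RE subr0 -mulrDl mulr_algr addrA subrK -scalerBl scalerA mulr_algl.
by rewrite mulrC.
Qed.

End FusionStep.

(** Evaluating a spectral parameter changes the polynomial scalars too, so it
    is semilinear with respect to the substitution chi in the scalars. *)
Section SemilinearImage.
Variables (C : comNzRingType) (B : algType C) (q : C) (s : nat -> B).
Variables (phi : B -> B) (chi : C -> C).
Hypotheses (phiM : {morph phi : a b / a * b}) (phiD : {morph phi : a b / a + b})
  (phiB : {morph phi : a b / a - b}) (phiZ : forall p a, phi (p *: a) = chi p *: phi a)
  (phi1 : phi 1 = 1) (chiB : {morph chi : a b / a - b})
  (chiM : {morph chi : a b / a * b}) (chi_q : chi q = q)
  (phi_s : forall i, phi (s i) = s i).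

Lemma semilinear_fusion_row xs u :
  phi (fusion_row q s xs u) = fusion_row q s (map chi xs) (chi u).
Proof.
elim: xs => [|x xs IHxs] //=; rewrite !phiM IHxs size_map /baxter phiB phiD !phiZ.
by rewrite !phi_s phi1 chiB chiM chi_q.
Qed.

Lemma semilinear_fusion_rows ys xs :
  phi (fusion_rows q s ys xs) = fusion_rows q s (map chi ys) (map chi xs).
Proof.
by elim: ys => [|y ys IHys] //=; rewrite phiM IHys semilinear_fusion_row map_cat.
Qed.

Lemma semilinear_pole (Y R Q E : B) (u sigma P : C) :
  phi Y = Y -> phi R = R -> phi E = E -> chi u = sigma -> chi sigma = sigma ->
  (u%:A - Y) * Q = P%:A - R ->
  phi ((P%:A + (Y - sigma%:A) * Q) * E) = R * E.
Proof.
move=> pY pR pE cu cs /(congr1 phi).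
rewrite phiM !phiB !phiZ phi1 pY pR cu => eQ.
rewrite phiM phiD phiM phiB !phiZ phi1 pY pE cs; congr (_ * _).
by rewrite -opprB mulNr eQ opprB addrC subrK.
Qed.

End SemilinearImage.

Lemma scale_rearrange (C : comNzRingType) (B : algType C) (FE Z : B)
    (u1 us P Pi N hn hd : C) :
  (Pi * (us * P)) *: FE = (u1 * N) *: Z -> u1 * N * hd = us * hn * Pi ^+ 2 ->
  (us * Pi) *: ((P * hd) *: FE) = (us * Pi) *: (Pi *: (hn *: Z)).
Proof.
move=> e key; rewrite !scalerA [X in X *: FE](_ : _ = hd * (Pi * (us * P))); last by ring.
rewrite -[LHS]scalerA e scalerA; congr (_ *: _).
by rewrite mulrC key; ring.
Qed.

(** * Polynomials in the spectral parameters *)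

(** A copy of the polynomials with coefficients in A that carries the
    structure of algebra over the central polynomials with coefficients in F. *)
Definition upoly (F : fieldType) (A : algType F) (n : nat) := {mpoly A[n]}.

Section UPoly.
Variables (F : fieldType) (A : algType F) (n : nat).
HB.instance Definition _ := GRing.NzRing.on (upoly A n).

Definition upoly_scale (p : {mpoly F[n]}) (N : upoly A n) : upoly A n :=
  mplift A p * N.

Lemma upoly_scaleA a b N : upoly_scale a (upoly_scale b N) = upoly_scale (a * b) N.
Proof. by rewrite /upoly_scale mulrA mpliftM. Qed.
Lemma upoly_scale1 : left_id 1 upoly_scale.
Proof. by move=> N; rewrite /upoly_scale /mplift rmorph1 mul1r. Qed.
Lemma upoly_scaleDr : right_distributive upoly_scale +%R.
Proof. by move=> p M N; rewrite /upoly_scale mulrDr. Qed.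
Lemma upoly_scaleDl N : {morph upoly_scale^~ N : a b / a + b}.
Proof. by move=> a b; rewrite /upoly_scale /mplift rmorphD mulrDl. Qed.
HB.instance Definition _ := GRing.Zmodule_isLmodule.Build {mpoly F[n]} (upoly A n)
  upoly_scaleA upoly_scale1 upoly_scaleDr upoly_scaleDl.
Lemma upoly_scaleAl (p : {mpoly F[n]}) (M N : upoly A n) : p *: (M * N) = p *: M * N.
Proof. exact: mulrA. Qed.
HB.instance Definition _ :=
  GRing.Lmodule_isLalgebra.Build {mpoly F[n]} (upoly A n) upoly_scaleAl.
Lemma upoly_scaleAr (p : {mpoly F[n]}) (M N : upoly A n) : p *: (M * N) = M * (p *: N).
Proof.
rewrite -[LHS]/(mplift A p * (M * N)) -[p *: N]/(mplift A p * N).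
by rewrite !mulrA -mplift_comm.
Qed.
HB.instance Definition _ :=
  GRing.Lalgebra_isAlgebra.Build {mpoly F[n]} (upoly A n) upoly_scaleAr.

Lemma upoly_scaleE (p : {mpoly F[n]}) (N : upoly A n) : p *: N = mplift A p * N.
Proof. by []. Qed.
Lemma upoly_algE (p : {mpoly F[n]}) : p%:A = mplift A p :> upoly A n.
Proof. exact: mulr1. Qed.

Definition ulift (a : A) : upoly A n := a%:MP.
Lemma uliftM : {morph ulift : a b / a * b}. Proof. exact: mpolyCM. Qed.
Lemma uliftD : {morph ulift : a b / a + b}. Proof. exact: mpolyCD. Qed.
Lemma uliftB : {morph ulift : a b / a - b}. Proof. exact: mpolyCB. Qed.
Lemma ulift1 : ulift 1 = 1. Proof. exact: mpolyC1. Qed.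
Lemma ulift0 : ulift 0 = 0. Proof. exact: mpolyC0. Qed.
Lemma uliftZ c a : ulift (c *: a) = c%:MP *: ulift a.
Proof.
by rewrite upoly_scaleE /mplift map_mpolyC /= -[RHS]uliftM mulr_algl.
Qed.

Variables (q : F) (k : nat) (s : nat -> A).
Hypothesis hs : hecke_generators q k s.
Definition ugen (i : nat) : upoly A n := ulift (s i).

Lemma ugen_hecke : hecke_generators q%:MP k ugen.
Proof.
split=> [i i0 ik|i j i0 ij jk|i i0 ik]; rewrite /ugen -?uliftM.
- by rewrite (gen_braid hs).
- by rewrite (gen_comm hs).
by rewrite (gen_quad hs) // uliftD ulift1 uliftZ.
Qed.

Lemma ujm i : jm ugen i = ulift (jm s i).
Proof.
elim: i => [|[|i] IHi]; first exact/esym/ulift1.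
  exact/esym/ulift1.
by rewrite [in LHS]jmS // [in RHS]jmS // IHi -!uliftM.
Qed.

Lemma uweight xs z : weight s xs z -> weight ugen (map (@mpolyC n F) xs) (ulift z).
Proof.
elim: xs => //= x xs IHxs [wz e]; split; first exact: IHxs.
by rewrite size_map ujm -uliftM e uliftZ.
Qed.

Lemma uroot_prod Y cs : root_prod (ulift Y) (map (@mpolyC n F) cs) = ulift (root_prod Y cs).
Proof.
elim: cs => [|c cs IHcs]; first by rewrite /root_prod !big_nil ulift1.
by rewrite /= !root_prod_cons IHcs uliftM uliftB uliftZ ulift1.
Qed.

Section Substitution.
Variables (i : 'I_n) (r : F).
Definition usubst (N : upoly A n) : upoly A n := psubst i r%:A N.
Definition csubst (p : {mpoly F[n]}) : {mpoly F[n]} := psubst i r p.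

Lemma usubstM : {morph usubst : a b / a * b}. Proof. exact: psubstM. Qed.
Lemma usubstD : {morph usubst : a b / a + b}. Proof. exact: mmapD. Qed.
Lemma usubstB : {morph usubst : a b / a - b}. Proof. exact: mmapB. Qed.
Lemma usubst_lift a : usubst (ulift a) = ulift a. Proof. exact: mmapC. Qed.
Lemma usubst_gen j : usubst (ugen j) = ugen j. Proof. exact: usubst_lift. Qed.
Lemma usubstZ p N : usubst (p *: N) = csubst p *: usubst N.
Proof. by rewrite !upoly_scaleE usubstM -psubst_lift. Qed.
Lemma usubst1 : usubst 1 = 1. Proof. by rewrite -ulift1 usubst_lift. Qed.

HB.instance Definition _ := GRing.RMorphism.copy csubst
  (mmap (@mpolyC n F) (fun j => if j == i then r%:MP else 'X_j)).

Lemma csubstC c : csubst c%:MP = c%:MP. Proof. exact: mmapC. Qed.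
Lemma csubstX j : csubst 'X_j = if j == i then r%:MP else 'X_j.
Proof. by rewrite /csubst /psubst mmapX mmap1U. Qed.

Lemma csubst_morph : (forall a b, csubst (a - b) = csubst a - csubst b) /\
  (forall a b, csubst (a * b) = csubst a * csubst b).
Proof. by split=> a b; rewrite ?rmorphB ?rmorphM. Qed.

Lemma usubst_pole (Y R E : A) (Q : upoly A n) (u P : {mpoly F[n]}) : csubst u = r%:MP ->
  (u%:A - ulift Y) * Q = P%:A - ulift R ->
  usubst ((P%:A + (ulift Y - r%:MP%:A) * Q) * ulift E) = ulift (R * E).
Proof.
move=> cu eQ; rewrite uliftM; apply: semilinear_pole eQ; [exact: usubstM|exact: usubstD
  |exact: usubstB|exact: usubstZ|exact: usubst1|exact: usubst_lift|exact: usubst_lift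
  |exact: usubst_lift|exact: cu|exact: csubstC].
Qed.

Lemma usubst_fusion_rows ys xs : usubst (fusion_rows q%:MP ugen ys xs) =
  fusion_rows q%:MP ugen (map csubst ys) (map csubst xs).
Proof.
apply: semilinear_fusion_rows; [exact: usubstM|exact: usubstD|exact: usubstB
  |exact: usubstZ|exact: usubst1|exact: (proj1 csubst_morph)|exact: (proj2 csubst_morph)
  |exact: csubstC|exact: usubst_gen].
Qed.

End Substitution.
End UPoly.

(** * The function Psi as a fusion product *)

Lemma baxter_row_iota (C : comNzRingType) (B : algType C) (p : C) (g : nat -> B) (f : nat -> C) m l y :
  baxter_row p g 0 [seq f i | i <- iota m l] y =
  \prod_(m <= j < m + l) baxter p g (m + l - j) (f j) y.
Proof.
elim: l m => [|l IHl] m; first by rewrite addn0 big_geq.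
rewrite big_ltn; last by lia.
rewrite /= size_map size_iota IHl addnS addSn; congr (baxter _ _ _ _ _ * _); lia.
Qed.

Lemma rev_iotaS l : rev (iota 1 l.+1) = l.+1 :: rev (iota 1 l).
Proof. by rewrite -(addn1 l) iotaD rev_cat addn1. Qed.

Lemma baxter_rows_iota (C : comNzRingType) (B : algType C) (p : C) (g : nat -> B) (f : nat -> C) l :
  (0 < l)%N -> baxter_rows p g 0 [seq f i | i <- rev (iota 1 l)] =
  \prod_(1 <= i < l) \prod_(1 <= j < i.+1) baxter p g (i.+1 - j) (f j) (f i.+1).
Proof.
case: l => // l _; elim: l => [|l IHl]; first by rewrite big_geq //= mul1r.
rewrite rev_iotaS map_cons [RHS]big_nat_recr // -IHl; congr (_ * _).
by rewrite -map_rev revK baxter_row_iota.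
Qed.

(** The denominators of [fusion_rows]. *)
Fixpoint fusion_den (R : comNzRingType) (ys xs : seq R) : R :=
  if ys is y :: ys' then \prod_(x <- ys' ++ xs) (y - x) * fusion_den ys' xs else 1.

Lemma fusion_den_rcons (R : comNzRingType) (ys : seq R) y xs :
  fusion_den (rcons ys y) xs = fusion_den ys (y :: xs) * \prod_(x <- xs) (y - x).
Proof.
elim: ys => [|z ys IHys] /=; first by rewrite mul1r mulr1.
by rewrite IHys mulrA -cats1 -catA.
Qed.

Lemma fusion_den_iota (R : comNzRingType) (f : nat -> R) l :
  (0 < l)%N -> fusion_den [seq f i | i <- rev (iota 1 l)] [::] =
  \prod_(1 <= i < l) \prod_(1 <= j < i.+1) (f i.+1 - f j).
Proof.
case: l => // l _; elim: l => [|l IHl]; first by rewrite big_geq //= big_nil mulr1.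
rewrite rev_iotaS map_cons [RHS]big_nat_recr // -IHl [RHS]mulrC; congr (_ * _).
by rewrite cats0 big_map; apply: perm_big; rewrite perm_rev.
Qed.

Section PsiAsFusion.
Variables (F : fieldType) (v t : F) (k : nat).
Hypotheses (v0 : v != 0) (t0 : t != 0).
Local Notation q := (v^-1 - v).
Local Notation H := (hecke v t k).

Definition normalized_gen (i : nat) : H := t^-1 *: hT v t k i.
Local Notation s := normalized_gen.

Lemma hT_ord i (ik : (i.-1 < k.-1)%N) : hT v t k i = hecke_gen v t (Ordinal ik).
Proof.
rewrite /hT; case: insubP => [j _ ej|]; last by rewrite ik.
by congr (hecke_gen _ _ _); apply: val_inj.
Qed.

Lemma hT_quad i : (0 < i)%N -> (i < k)%N ->
  hT v t k i * hT v t k i = (t ^+ 2)%:A + (q * t) *: hT v t k i.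
Proof.
move=> i0 ik; have ik' : (i.-1 < k.-1)%N by lia.
rewrite (hT_ord ik'); move: (hecke_quad (hecke_gen_relations v t k) (Ordinal ik')).
move: (hecke_gen _ _ _) => T.
rewrite mulrDr !mulrBl mulr_algl !mulr_algr scalerA => e.
have tt : v * t * (v^-1 * t) = t ^+ 2 by field.
apply/eqP; rewrite -subr_eq0 -[X in _ == X]e; apply/eqP; rewrite opprD addrA.
by rewrite -tt scalerBl opprB [LHS](AC (2*2) ((1*4)*(3*2))).
Qed.

Lemma normalized_gen_relations : hecke_generators q k s.
Proof.
have r := hecke_gen_relations v t k.
split=> [i i0 ik|i j i0 ij jk|i i0 ik]; rewrite /s -!scalerAl -!scalerAr -?scalerAl.
- have ii : (i.-1 < k.-1)%N by lia.
  have jj : (i.+1.-1 < k.-1)%N by lia.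
  rewrite (hT_ord ii) (hT_ord jj) (hecke_braid r) //=; lia.
- have ii : (i.-1 < k.-1)%N by lia.
  have jj : (j.-1 < k.-1)%N by lia.
  rewrite (hT_ord ii) (hT_ord jj) (hecke_comm r) //=; lia.
rewrite hT_quad // !scalerDr !scalerA; congr (_ + _ *: _); last first.
  by field; rewrite t0.
rewrite -[RHS]scale1r; congr (_ *: _); by field.
Qed.

Lemma jm_jucys_murphy i : jm s i = jucys_murphy v t k i.
Proof.
elim: i => [|[|i] IHi] //; rewrite jmS // IHi.
rewrite [RHS]/= -/(jucys_murphy v t k i.+1) /s -!scalerAl -!scalerAr -?scalerAl scalerA.
by congr (_ *: _); rewrite expr2 invfM.
Qed.

Lemma uvarE i (ik : (i < k)%N) : uvar F k i.+1 = 'X_(Ordinal ik).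
Proof.
rewrite /uvar; case: insubP => [j _ ej|]; last by rewrite ik.
by congr 'X_(_); apply: val_inj.
Qed.

Lemma longest_hT l : (0 < l)%N ->
  \prod_(1 <= i < l) \prod_(j <- rev (iota 1 i)) hT v t k j =
  t ^+ (l * (l - 1) %/ 2)%N *: longest s l.
Proof.
have coxE m : \prod_(j <- rev (iota 1 m)) hT v t k j = t ^+ m *: cox s m.
  elim: m => [|m IHm]; first by rewrite big_nil scale1r.
  rewrite rev_iotaS big_cons IHm /= exprS -scalerAr /s -scalerAl !scalerA.
  by rewrite mulrAC mulfV ?mul1r.
case: l => // l _; elim: l => [|l IHl]; first by rewrite big_geq //= mul1r scale1r.
rewrite big_nat_recr // IHl coxE /= -scalerAl -scalerAr scalerA -exprD.
congr (t ^+ _ *: _).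
rewrite !subn1 /=.
have -> : (l.+2 * l.+1 = l.+1 * l + l.+1 * 2)%N by lia.
by rewrite divnDMl.
Qed.

Lemma hT_xy_num i x y : rf_num (hT_xy v t i x y) =
  baxter q%:MP (ugen k s) i x y :> upoly H k.
Proof.
transitivity ((s i)%:MP * mplift H (y - x) + mplift H (q *: x) * mplift H 1 : upoly H k).
  by [].
have -> : @mplift F H k 1 = 1 by exact: rmorph1.
rewrite mulr1; congr (_ + _); first exact: mplift_comm.
by rewrite -mul_mpolyC; exact/esym/upoly_algE.
Qed.

Lemma hT_xy_den i (x y : {mpoly F[k]}) : rf_den (hT_xy v t i x y) = y - x.
Proof. exact: mul1r. Qed.

Lemma rf_num_big (I : Type) (r : seq I) (Phi : I -> ratfun H k) :
  rf_num (\big[@rf_mul _ _ _ / rf_cst k (1 : H)]_(i <- r) Phi i) =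
  \prod_(i <- r) rf_num (Phi i).
Proof. by apply: (big_morph (@rf_num F H k)) => //; exact: mpolyC1. Qed.

Lemma rf_den_big (I : Type) (r : seq I) (Phi : I -> ratfun H k) :
  rf_den (\big[@rf_mul _ _ _ / rf_cst k (1 : H)]_(i <- r) Phi i) =
  \prod_(i <- r) rf_den (Phi i).
Proof. exact: (big_morph (@rf_den F H k)). Qed.

Definition uvars (m : nat) : seq {mpoly F[k]} :=
  [seq uvar F k i | i <- rev (iota m.+1 (k - m))].

Lemma ucox n : cox (ugen k s) n = ulift k (cox s n).
Proof.
elim: n => [|n IHn] /=; first exact/esym/ulift1.
by rewrite IHn -uliftM.
Qed.

Lemma ulongest n : longest (ugen k s) n = ulift k (longest s n).
Proof.
elim: n => [|n IHn] /=; first exact/esym/ulift1.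
by rewrite IHn ucox -uliftM.
Qed.

(** The power of t comes from the rescaling of the generators; it cancels the
    power of t in f. *)
Lemma hT_longest_inv : (0 < k)%N ->
  longest s k * (hT_longest v t k)^-1 = (t ^- (k * (k - 1) %/ 2)%N)%:A.
Proof.
move=> k0; have tN : t ^+ (k * (k - 1) %/ 2)%N != 0 by rewrite expf_neq0.
have u := hT_longest_unit k v0 t0.
apply: (scalerI tN); rewrite scalerA mulfV // scale1r scalerAl -longest_hT //.
exact: divrr.
Qed.

Lemma Psi_num : (0 < k)%N -> rf_num (Psi v t k) =
  (t ^- (k * (k - 1) %/ 2)%N)%:MP *: fusion_rows q%:MP (ugen k s) (uvars 0) [::]
    :> upoly H k.
Proof.
move=> k0; rewrite /Psi.
transitivity ((baxter_rows q%:MP (ugen k s) 0 (uvars 0) : upoly H k) *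
   ulift k (hT_longest v t k)^-1).
  rewrite -[LHS]/(_ * _); congr (_ * _); rewrite rf_num_big /uvars subn0.
  rewrite baxter_rows_iota //; apply: eq_bigr => i _; rewrite rf_num_big.
  by apply: eq_bigr => j _; exact: hT_xy_num.
have -> : baxter_rows q%:MP (ugen k s) 0 (uvars 0) =
    fusion_rows q%:MP (ugen k s) (uvars 0) [::] * ulift k (longest s k).
  have sz : size (uvars 0) = k by rewrite size_map size_rev size_iota subn0.
  rewrite (baxter_rows_fusion (ugen_hecke k normalized_gen_relations)) ?sz //.
  by congr (_ * _); exact: ulongest.
rewrite -mulrA -uliftM hT_longest_inv // uliftZ ulift1.
by rewrite -scalerAr mulr1.
Qed.

Lemma Psi_den : (0 < k)%N -> rf_den (Psi v t k) = fusion_den (uvars 0) [::].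
Proof.
move=> k0; rewrite /Psi -[LHS]/(_ * 1) mulr1 rf_den_big /uvars subn0.
rewrite fusion_den_iota //; apply: eq_bigr => i _; rewrite rf_den_big.
by apply: eq_bigr => j _; exact: hT_xy_den.
Qed.

End PsiAsFusion.

(** * Idempotents of chains of diagrams *)

Section Idempotents.
Variables (F : fieldType) (v : F) (A : algType F) (k : nat) (s : nat -> A).
Hypotheses (v0 : v != 0) (v_generic : forall n, (0 < n)%N -> v ^+ n != 1).
Local Notation q := (v^-1 - v).
Hypothesis hs : hecke_generators q k s.
Local Notation y := (jm s).
Local Notation cont := (map (content v)).

Definition other_contents (D : seq cell) (c : cell) : seq F :=
  [seq content v d | d <- addable_cells D & d != c].

(** The idempotents of the statement, for a tableau encoded by its chain of
    cells. *)
Fixpoint chain_idempotent (D : seq cell) : A :=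
  if D is c :: D' then
    chain_idempotent D' * ((\prod_(x <- other_contents D' c) (content v c - x))^-1 *:
       root_prod (y (size D)) (other_contents D' c))
  else 1.

Lemma chain_idempotent_comm z D :
  (forall i, (0 < i)%N -> (i <= size D)%N -> GRing.comm z (y i)) ->
  GRing.comm z (chain_idempotent D).
Proof.
elim: D => [|c D IHD] h /=; first exact: commr1.
apply: commrM; first by apply: IHD => i i0 /leqW; exact: h.
rewrite /GRing.comm -scalerAr -scalerAl; congr (_ *: _).
by apply: root_prod_comm; apply: h.
Qed.

Lemma other_contents_perm D c : standard D -> can_add D c ->
  perm_eq (cont (addable_cells D)) (content v c :: other_contents D c).
Proof.
move=> sD ac; rewrite -map_cons; apply: perm_map.
rewrite -[[seq d <- _ | _]](rem_filter c (addable_uniq D)).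
by apply: perm_to_rem; rewrite mem_addable.
Qed.

Lemma other_contents_neq D c x : standard D -> can_add D c ->
  x \in other_contents D c -> content v c - x != 0.
Proof.
move=> sD ac /mapP[d]; rewrite mem_filter => /andP[dc]; rewrite mem_addable // => ad ->.
rewrite subr_eq0; apply/eqP => /(content_inj v0 v_generic) e.
by case: (can_add_gap sD ad ac dc); rewrite e; clear; lia.
Qed.

Lemma chain_idempotent_root_prod D c : standard D -> can_add D c -> (size D < k)%N ->
  weight s (cont D) (chain_idempotent D) ->
  root_prod (y (size D).+1) (content v c :: other_contents D c) * chain_idempotent D = 0.
Proof.
move=> sD ac Dk wE; rewrite -(root_prod_perm _ (other_contents_perm sD ac)).
exact: (spectrum v0 v_generic hs).
Qed.

(** The last factor removes all addable contents but that of c from the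
    spectrum of the next Jucys-Murphy element. *)
Lemma chain_idempotent_weight D : standard D -> (size D <= k)%N ->
  weight s (cont D) (chain_idempotent D).
Proof.
elim: D => //= c D IHD /andP[sD ac] Dk.
have wE := IHD sD (ltnW Dk); split; first exact: weight_mulr.
rewrite size_map; have R0 := chain_idempotent_root_prod sD ac Dk wE.
rewrite root_prod_cons in R0.
set R := root_prod _ _ in R0 *; set E := chain_idempotent D in R0 *.
have cE : GRing.comm (y (size D).+1) E.
  by apply: chain_idempotent_comm => i i0 iD; apply: (jm_comm hs); move: iD Dk; clear; lia.
have cR : E * R = R * E by apply: root_prod_comm; exact: commr_sym.
rewrite -!scalerAr cR scalerA mulrC -scalerA; congr (_ *: _).
by apply/eqP; rewrite -subr_eq0 -[content v c *: _]mulr_algl -mulrBl mulrA R0.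
Qed.

End Idempotents.

(** * Consecutive evaluations *)

Section Evaluation.
Variables (F : fieldType) (v : F) (A : algType F) (k : nat) (s : nat -> A).
Hypotheses (v0 : v != 0) (v_generic : forall n, (0 < n)%N -> v ^+ n != 1).
Local Notation q := (v^-1 - v).
Hypothesis hs : hecke_generators q k s.
Local Notation cont := (map (content v)).
Local Notation cst := (map (@mpolyC k F)).
Local Notation E := (chain_idempotent v s).
Local Notation x := (v ^- 2).

Lemma upoly_scale_reg (p : {mpoly F[k]}) (M N : upoly A k) : p != 0 ->
  p *: M = p *: N -> M = N.
Proof.
by move=> p0 e; apply: (mplift_regI p0); rewrite !mplift_comm.
Qed.

Lemma mpolyXsubC_neq0 (i : 'I_k) (c : F) : 'X_i - c%:MP != 0 :> {mpoly F[k]}.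
Proof.
apply/eqP => /(congr1 (mcoeff U_(i)))/eqP.
by rewrite mcoeff0 mcoeffB mcoeffX mcoeffC eqxx mnm1_eq0 mulr0 subr0 oner_eq0.
Qed.

Lemma csubst_horner (i : 'I_k) r (p : {poly F}) :
  csubst i r (horner_alg ('X_i : {mpoly F[k]}) p) = p.[r]%:MP.
Proof.
elim/poly_ind: p => [|p c IHp]; first by rewrite !rmorph0 horner0 mpolyC0.
rewrite !rmorphD !rmorphM /= IHp horner_algX horner_algC csubstX eqxx.
by rewrite hornerMXaddC mpolyCD mpolyCM alg_mpolyC csubstC.
Qed.

Lemma csubst_prod (i : 'I_k) r (I : Type) (l : seq I) (f : I -> {mpoly F[k]}) :
  csubst i r (\prod_(j <- l) f j) = \prod_(j <- l) csubst i r (f j).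
Proof. exact: rmorph_prod. Qed.

Lemma csubst_cst (i : 'I_k) r (cs : seq F) : map (csubst i r) (cst cs) = cst cs.
Proof. by rewrite -map_comp; apply: eq_map => c /=; rewrite csubstC. Qed.

(** One evaluation. The fraction N / d represents the fusion factor, applied
    to the idempotent of D, in a form whose denominator does not vanish at the
    content of c; the value there is the idempotent of the enlarged chain,
    multiplied by a quotient of hook products. The vanishing factor u - sigma
    has been cancelled on both sides. *)
Lemma fusion_step D c (i : 'I_k) : standard D -> can_add D c -> i = size D :> nat ->
  exists (N : upoly A k) d (e : F),
  [/\ d *: (fusion_row q%:MP (ugen k s) (cst (cont D)) 'X_i * ulift k (E D)) =
        (\prod_(a <- cst (cont D)) ('X_i - a)) *: N :> upoly A k,
      csubst i (content v c) d = e%:MP, e != 0 &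
      (hook_product x (c :: D))%:MP *: usubst i (content v c) N =
        (e * hook_product x D)%:MP *: ulift k (E (c :: D))].
Proof.
move=> sD ac iD; have Dk : (size D < k)%N by rewrite -iD.
have wE := chain_idempotent_weight v0 v_generic hs sD (ltnW Dk).
have R0 := chain_idempotent_root_prod v0 v_generic hs sD ac Dk wE.
set rho := other_contents v D c in R0; set sigma := content v c in R0 *.
set u : {mpoly F[k]} := 'X_i.
(* h evaluates a polynomial at the parameter u *)
have [h [h_X hC csh]] : exists h : {rmorphism {poly F} -> {mpoly F[k]}},
    [/\ h 'X = u, forall a, h a%:P = a%:MP
      & forall p, csubst i sigma (h p) = p.[sigma]%:MP].
  exists (horner_alg u); split=> [|a|p].
  - exact: horner_algX.
  - by apply: (etrans (horner_algC _ _)); rewrite alg_mpolyC.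
  exact: csubst_horner.
have [num [den [poly_id den0 hookE]]] := fusion_scalar v0 v_generic sD ac.
rewrite -/sigma in poly_id den0 hookE.
have us := ugen_hecke k hs.
set y := jm s (size D).+1 in R0.
have [Q [eQ cQ]] := divided_difference (ulift k y) u (cst rho).
have sz : size (cst (cont D)) = size D by rewrite !size_map.
pose P := \prod_(a <- cst rho) (u - a).
pose Z : upoly A k := (P%:A + (ulift k y - sigma%:MP%:A) * Q) * ulift k (E D).
have yE : jm (ugen k s) (size (cst (cont D))).+1 = ulift k y by rewrite sz ujm.
have pole := @fusion_row_pole _ _ _ _ _ us (cst (cont D)) (cst rho) u sigma%:MP (ulift k (E D)) Q.
rewrite yE sz in pole.
have {}pole := pole Dk (uweight k wE) eQ cQ.
have {}pole := pole (etrans (congr1 (fun z => z * _) (uroot_prod k y (sigma :: rho)))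
  (etrans (esym (uliftM _ _ _)) (etrans (congr1 _ R0) (ulift0 _ _)))).
pose Pi := \prod_(a <- cst (cont D)) (u - a).
pose Nq := \prod_(a <- cst (cont D)) ((u - a) ^+ 2 - q%:MP ^+ 2 * a * u).
rewrite -/P -/Pi -/Nq -/Z in pole.
have hX a : h ('X - a%:P) = u - a%:MP by rewrite rmorphB h_X hC.
have key : (u - 1) * Nq * h den = (u - sigma%:MP) * h num * Pi ^+ 2.
  have := congr1 h poly_id; rewrite !rmorphM !rmorph_prod /= (hX sigma).
  have -> : h ('X - 1) = u - 1 by rewrite rmorphB rmorph1 h_X.
  have -> : \prod_(a <- D) h (('X - (content v a)%:P) ^+ 2 - (q ^+ 2 * content v a)%:P * 'X) = Nq.
    rewrite /Nq !big_map; apply: eq_bigr => a _.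
    rewrite rmorphB rmorphXn hX rmorphM h_X hC.
    by rewrite mpolyCM rmorphXn.
  move=> ->; congr (_ * _); rewrite -prodrXl !big_map; apply: eq_bigr => a _.
  by rewrite rmorphXn hX.
have Pi0 : Pi != 0.
  by rewrite /Pi big_map prodf_seq_neq0; apply/allP => a _; rewrite mpolyXsubC_neq0.
have csP : csubst i sigma P = (\prod_(a <- rho) (sigma - a))%:MP.
  rewrite csubst_prod big_map rmorph_prod; apply: eq_bigr => a _.
  by rewrite rmorphB /= csubstX eqxx csubstC mpolyCB.
have rho0 : \prod_(a <- rho) (sigma - a) != 0.
  rewrite prodf_seq_neq0; apply/allP => a ain.
  exact: (other_contents_neq v0 v_generic sD ac).
exists (h num *: Z), (P * h den), (\prod_(a <- rho) (sigma - a) * den.[sigma]).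
split.
- apply: (@upoly_scale_reg ((u - sigma%:MP) * Pi)).
    by rewrite mulf_neq0 // mpolyXsubC_neq0.
  exact: scale_rearrange pole key.
- by rewrite rmorphM /= csP csh mpolyCM.
- by rewrite mulf_neq0.
have usZ : usubst i sigma Z = ulift k (root_prod y rho * E D).
  have cu : csubst i sigma u = sigma%:MP by rewrite csubstX eqxx.
  by apply: (usubst_pole (E D) cu); rewrite eQ uroot_prod.
rewrite usubstZ usZ csh scalerA /= -/rho -/y -scalerAr uliftZ scalerA.
have cE : E D * root_prod y rho = root_prod y rho * E D.
  apply: root_prod_comm; apply/commr_sym/chain_idempotent_comm => j j0 jD.
  by apply: (jm_comm hs); move: jD Dk; clear; lia.
have es : hook_product x (c :: D) * num.[sigma] =
    \prod_(a <- rho) (sigma - a) * den.[sigma] * hook_product x D *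
      (\prod_(a <- rho) (sigma - a))^-1 by rewrite hookE; field.
by rewrite -/sigma cE -!mpolyCM es.
Qed.

End Evaluation.

Lemma csubst_fusion_den (F : fieldType) n (i : 'I_n) (r : F) ys xs :
  csubst i r (fusion_den ys xs) =
  fusion_den (map (csubst i r) ys) (map (csubst i r) xs).
Proof.
elim: ys => [|y ys IHys] /=; first exact: rmorph1.
rewrite (csubst_morph i r).2 IHys csubst_prod -map_cat big_map; congr (_ * _).
by apply: eq_bigr => a _; rewrite (csubst_morph i r).1.
Qed.

Lemma fusion_den_neq0 (R : idomainType) (ys xs : seq R) :
  uniq ys -> (forall a, a \in ys -> a \notin xs) -> fusion_den ys xs != 0.
Proof.
elim: ys => [|y ys IHys] /=; first by rewrite oner_neq0.
move=> /andP[yn u] d; rewrite mulf_neq0 ?IHys //; last first.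
  by move=> a ain; apply: d; rewrite inE ain orbT.
rewrite prodf_seq_neq0; apply/allP => a; rewrite /= subr_eq0 mem_cat => ain.
apply: contraTneq ain => <-; rewrite negb_or yn; apply: d; exact: mem_head.
Qed.

Lemma rf_eq_scale (F : fieldType) (A : algType F) n (M N : upoly A n)
    (d e : {mpoly F[n]}) : d != 0 -> e != 0 -> e *: M = d *: N ->
  rf_eq (RatFun M d : ratfun A n) (RatFun N e).
Proof.
move=> d0 e0 eMN; split; [exact: d0 | exact: e0 |].
exact: (etrans (mplift_comm e M) (etrans eMN (esym (mplift_comm d N)))).
Qed.

Lemma scale_step (C : comNzRingType) (B : algType C) (fd d p sc : C) (FR X E N : B) :
  d *: (X * E) = p *: N ->
  (fd * d) *: (sc *: (FR * X * E)) = (fd * p) *: (sc *: (FR * N)).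
Proof.
move=> e; rewrite -mulrA !scalerA.
have -> : fd * d * sc = fd * sc * d by ring.
have -> : fd * p * sc = fd * sc * p by ring.
by rewrite -scalerA scalerAr e -scalerAr scalerA.
Qed.

Lemma scale_substitute (C : comNzRingType) (B : algType C) (fd e sc sc' : C) (FR N E : B) :
  sc *: N = (e * sc') *: E ->
  fd *: (sc *: (FR * N)) = (fd * e) *: (sc' *: (FR * E)).
Proof.
move=> eq; rewrite -[RHS]scalerA; congr (_ *: _).
by rewrite scalerAr eq -scalerAr scalerA.
Qed.

Lemma scale_swap (C : comNzRingType) (V : lmodType C) (a b : C) (z : V) :
  a *: (b *: z) = b *: (a *: z).
Proof. by rewrite !scalerA mulrC. Qed.

Section Main.
Variables (F : fieldType) (v t : F) (k : nat).
Hypotheses (v0 : v != 0) (t0 : t != 0).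
Hypothesis v_generic : forall n, (0 < n)%N -> v ^+ n != 1.
Hypothesis k0 : (0 < k)%N.
Local Notation q := (v^-1 - v).
Local Notation x := (v ^- 2).
Local Notation H := (hecke v t k).
Local Notation s := (normalized_gen v t k).
Local Notation cst := (map (@mpolyC k F)).

Lemma uvars_rcons m : (m < k)%N ->
  uvars F k m = rcons (uvars F k m.+1) (uvar F k m.+1).
Proof.
move=> mk; rewrite /uvars -map_rcons -rev_cons; congr (map _ (rev _)).
by rewrite -(subnSK mk).
Qed.

Lemma uvars_uniq m : uniq (uvars F k m).
Proof.
rewrite map_inj_in_uniq ?rev_uniq ?iota_uniq // => i j.
rewrite !mem_rev !mem_iota => hi hj.
have [i' ei] : exists i', i = i'.+1 by case: i hi => // i'; exists i'.
have [j' ej] : exists j', j = j'.+1 by case: j hj => // j'; exists j'.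
have ik : (i' < k)%N by move: hi; rewrite ei; clear; lia.
have jk : (j' < k)%N by move: hj; rewrite ej; clear; lia.
rewrite ei ej (uvarE _ ik) (uvarE _ jk) => /(congr1 (mcoeff U_(Ordinal jk)))/eqP.
rewrite !mcoeffXU eqxx; case: (_ =P Ordinal jk) => [[->] //|_].
by rewrite eq_sym oner_eq0.
Qed.

Lemma uvars_cst m (cs : seq F) a : a \in uvars F k m -> a \notin cst cs.
Proof.
case/mapP => j; rewrite mem_rev mem_iota => hj ->.
have [j' ej] : exists j', j = j'.+1 by case: j hj => // j'; exists j'.
have jk : (j' < k)%N by move: hj; rewrite ej; clear; lia.
rewrite ej (uvarE _ jk); apply/mapP => -[c _] /eqP.
by rewrite -subr_eq0 (negPf (mpolyXsubC_neq0 _ _)).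
Qed.

Lemma csubst_uvars m (mk : (m < k)%N) r :
  map (csubst (Ordinal mk) r) (uvars F k m.+1) = uvars F k m.+1.
Proof.
rewrite -[RHS]map_id; apply/eq_in_map => a /mapP[j]; rewrite mem_rev mem_iota => hj ->.
have [j' ej] : exists j', j = j'.+1 by case: j hj => // j'; exists j'.
have jk : (j' < k)%N by move: hj; rewrite ej; clear; lia.
rewrite ej (uvarE _ jk) csubstX; case: eqP => // -[e].
by exfalso; move: hj; rewrite ej; move: e; clear; lia.
Qed.

Variable D : nat -> seq cell.
Variable c : nat -> cell.
Hypothesis D0 : D 0 = [::].
Hypothesis DS : forall m, (m < k)%N -> D m.+1 = c m.+1 :: D m.
Hypothesis sD : standard (D k).

Lemma prefix_size m : (m <= k)%N -> size (D m) = m.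
Proof. by elim: m => [|m IHm] mk; rewrite ?D0 // DS //= IHm // ltnW. Qed.

Lemma prefix_standard m : (m <= k)%N -> standard (D m).
Proof.
have h l : (l <= k)%N -> standard (D (k - l)).
  elim: l => [|l IHl] lk; first by rewrite subn0.
  have e : (k - l = (k - l.+1).+1)%N by rewrite subnSK.
  have := IHl (ltnW lk); rewrite e DS; last by rewrite -e leq_subr.
  by case/andP.
by move=> mk; rewrite -(subKn mk); apply: h; rewrite leq_subr.
Qed.

Lemma prefix_can_add m : (m < k)%N -> can_add (D m) (c m.+1).
Proof. by move=> mk; have := prefix_standard mk; rewrite DS // => /andP[]. Qed.

Lemma hook_product_neq0 E : hook_product x E != 0.
Proof.
rewrite prodf_seq_neq0; apply/allP => a _ /=.
have x1 : 1 - x != 0 by have := step_generic v_generic (isT : 0 < 1)%N; rewrite expr1.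
by rewrite !mulf_neq0 ?invr_eq0 ?x1 ?expf_neq0 ?step_neq0 ?(step_generic v_generic).
Qed.

Let scal m := hook_product x (D k) / hook_product x (D m).
Let cont m := cst (map (content v) (D m)).

Let num m : upoly H k := (scal m)%:MP *:
  (fusion_rows q%:MP (ugen k s) (uvars F k m) (cont m) * ulift k (chain_idempotent v s (D m))).
Let chi m : ratfun H k := RatFun (num m) (fusion_den (uvars F k m) (cont m)).

Lemma chi_den_neq0 m : fusion_den (uvars F k m) (cont m) != 0.
Proof. by apply: fusion_den_neq0 (uvars_uniq m) _ => a; exact: uvars_cst. Qed.

(** The factors of the parameters not yet evaluated stand to the left of the
    current one and are carried along, the current parameter becoming a
    content in them. *)
Lemma evaluation_step (i : 'I_k) :
  evaluates_to i (content v (c i.+1)) (chi i) (chi i.+1).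
Proof.
have ik := ltn_ord i; have hs := normalized_gen_relations k v0 t0.
have [N [d [e [eqN csd e0 usN]]]] := fusion_step v0 v_generic hs
  (prefix_standard (ltnW ik)) (prefix_can_add ik) (esym (prefix_size (ltnW ik)) : i = size (D i) :> nat).
have iE : uvar F k i.+1 = 'X_i by rewrite (uvarE _ ik); congr 'X_(_); exact: val_inj.
pose FR := fusion_rows q%:MP (ugen k s) (uvars F k i.+1) ('X_i :: cont i).
pose FD := fusion_den (uvars F k i.+1) ('X_i :: cont i).
have FDi : fusion_den (uvars F k i) (cont i) =
    FD * \prod_(a <- cont i) ('X_i - a).
  by rewrite uvars_rcons // fusion_den_rcons iE.
have cs : map (csubst i (content v (c i.+1))) ('X_i :: cont i) = cont i.+1.
  by rewrite /cont DS //= csubst_cst csubstX eqxx.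
have cu : map (csubst i (content v (c i.+1))) (uvars F k i.+1) = uvars F k i.+1.
  by have := csubst_uvars ik (content v (c i.+1)); rewrite (_ : Ordinal ik = i) //; exact: val_inj.
have FD0 : FD * d != 0.
  rewrite mulf_neq0 //.
    by apply: contraNneq (chi_den_neq0 i) => FD0; rewrite FDi FD0 mul0r.
  apply: contraNneq e0 => d0; rewrite d0 in csd.
  by rewrite -(@mpolyC_eq0 k) -csd; apply/eqP; exact: rmorph0.
have csFD : csubst i (content v (c i.+1)) (FD * d) =
    fusion_den (uvars F k i.+1) (cont i.+1) * e%:MP.
  by rewrite (csubst_morph _ _).2 csd csubst_fusion_den cs cu.
have usFR : usubst i (content v (c i.+1)) FR =
    fusion_rows q%:MP (ugen k s) (uvars F k i.+1) (cont i.+1).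
  by rewrite usubst_fusion_rows cs cu.
have e1 : e%:MP != 0 :> {mpoly F[k]} by rewrite mpolyC_eq0.
have csFD0 : csubst i (content v (c i.+1)) (FD * d) != 0.
  by rewrite csFD mulf_neq0 // chi_den_neq0.
have key : fusion_den (uvars F k i.+1) (cont i.+1) *:
    usubst i (content v (c i.+1)) ((scal i)%:MP *: (FR * N)) =
    csubst i (content v (c i.+1)) (FD * d) *: num i.+1.
  rewrite csFD usubstZ csubstC usubstM usFR /num.
  apply: scale_substitute; rewrite -mpolyCM.
  have hn0 := hook_product_neq0 (D i.+1); have hi0 := hook_product_neq0 (D i).
  have es : scal i * (e * hook_product x (D i)) = hook_product x (D i.+1) * (e * scal i.+1).
    by rewrite /scal; field; rewrite hn0 hi0.
  apply: (@upoly_scale_reg _ _ _ (hook_product x (D i.+1))%:MP).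
    by rewrite mpolyC_eq0.
  rewrite -(DS ik) in usN; rewrite scale_swap usN !scalerA -!mpolyCM.
  exact: (congr1 (fun z => z%:MP *: _) es).
exists ((scal i)%:MP *: (FR * N) : upoly H k), (FD * d); split; first 1 last.
- exact: csFD0.
- exact: rf_eq_scale csFD0 (chi_den_neq0 i.+1) key.
apply: rf_eq_scale (chi_den_neq0 i) FD0 _.
rewrite FDi /num uvars_rcons // fusion_rows_rcons iE.
exact: scale_step.
Qed.

(** The intermediate functions are the remaining fusion factors applied to the
    idempotent of the diagram reached so far; the scalars start at f, up to
    the power of t, and end at 1. *)
Lemma fusion_consecutive :
  consecutive_evaluation (fun i => content v (c i))
    (rf_scale (t ^+ (k * (k - 1) %/ 2)%N * hook_product x (D k)) (Psi v t k))
    (rf_cst k (chain_idempotent v s (D k))).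
Proof.
exists chi; split; last 2 first.
- exact: evaluation_step.
- have numk : num k = ulift k (chain_idempotent v s (D k)).
    rewrite /num /uvars subnn /= mul1r /scal divff ?hook_product_neq0 //.
    by rewrite mpolyC1 scale1r.
  have denk : fusion_den (uvars F k k) (cont k) = 1 by rewrite /uvars subnn.
  rewrite /chi numk denk; split; [exact: oner_neq0 | exact: oner_neq0 | by []].
have den0 : fusion_den (uvars F k 0) (cont 0) = rf_den (Psi v t k).
  by rewrite Psi_den // /cont D0.
have dn0 := chi_den_neq0 0; have pn0 := dn0; rewrite den0 in pn0.
split; [exact: pn0 | exact: dn0 |].
have numE : rf_num (rf_scale (t ^+ (k * (k - 1) %/ 2)%N * hook_product x (D k))
    (Psi v t k)) = num 0.
  transitivity (ulift k ((t ^+ (k * (k - 1) %/ 2)%N * hook_product x (D k)) *: 1)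
     * rf_num (Psi v t k) : upoly H k); first exact: erefl.
  rewrite uliftZ ulift1 -scalerAl mul1r Psi_num // scalerA -mpolyCM.
  have -> : t ^+ (k * (k - 1) %/ 2)%N * hook_product x (D k) / t ^+ (k * (k - 1) %/ 2)%N
      = scal 0.
    rewrite /scal D0 [hook_product x [::]]big_nil divr1 mulrAC divff ?mul1r //.
    by rewrite expf_neq0.
  rewrite /num /cont D0 /= ulift1 mulr1; exact: erefl.
by rewrite /chi den0 numE.
Qed.

End Main.

(** * Standard tableaux as chains of diagrams *)

(** Lists of cells enter the definitions only through their sets of cells,
    which allows passing from the row-by-row list of a partition to the chain
    of a tableau. *)
Lemma addable_cells_perm D D' : perm_eq D D' -> addable_cells D = addable_cells D'.
Proof.
move=> p; rewrite /addable_cells (perm_size p); apply: eq_filter => c.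
have e : forall z, (z \in c :: D) = (z \in c :: D').
  by move=> z; rewrite !inE (perm_mem p).
by apply/asboolP/asboolP => -[cn [la pla ela]]; (split; [
  by rewrite ?(perm_mem p) // -(perm_mem p) | exists la => // z; rewrite ela e]).
Qed.

(** Conjugation of partitions, read on the lengths of rows. *)
Lemma count_leq_sorted (la : seq nat) m n : sorted geq la -> (0 < n)%N ->
  (m < count (leq n) la)%N = (n <= nth 0%N la m)%N.
Proof.
move=> + n0; elim: la m => [|l la IHla] m so; first by rewrite nth_nil leqn0 gtn_eqF.
have sla : sorted geq la by move: so => /= /path_sorted.
have all_le : all (geq l) la by move: so => /=; rewrite path_sortedE => [/andP[]|] // ? ? ? /[swap]; apply: leq_trans.
case: (leqP n l) => nl; rewrite /= ?nl; first by case: m => [|m] //=; rewrite -IHla.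
have -> : (n <= l)%N = false by rewrite leqNgt nl.
rewrite add0n.
have c0 : count (leq n) la = 0%N.
  apply/eqP; rewrite -leqn0 leqNgt -has_count; apply/hasPn => z /(allP all_le) /= zl.
  by rewrite -ltnNge; exact: leq_ltn_trans nl.
case: m => [|m] /=; first by rewrite c0 [RHS]leqNgt nl.
by rewrite -IHla // c0.
Qed.

Section Tableau.
Variables (k : nat) (la : seq nat) (T : cell -> nat).
Hypothesis la_part : is_partition la.
Hypothesis T_std : standard_tableau k la T.
Local Notation L := (cells la).
Local Notation c := (cell_of T L).

Definition tableau_cells (m : nat) : seq cell := [seq c i | i <- rev (iota 1 m)].
Local Notation D := tableau_cells.

Lemma tableau_cellsS m : D m.+1 = c m.+1 :: D m.
Proof. by rewrite /tableau_cells rev_iotaS. Qed.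

Lemma tableau_perm : perm_eq (map T L) (iota 1 k). Proof. by case: T_std. Qed.

Lemma tableau_uniq : uniq (map T L).
Proof. by rewrite (perm_uniq tableau_perm) iota_uniq. Qed.

Lemma tableau_inj : {in L &, injective T}.
Proof.
move=> a b aL bL e; rewrite -(nth_index (0%N,0%N) aL) -(nth_index (0%N,0%N) bL).
congr nth; apply/eqP; rewrite -(nth_uniq 0%N _ _ tableau_uniq) ?size_map ?index_mem //.
by rewrite !(nth_map (0%N, 0%N)) ?index_mem // !nth_index // e.
Qed.

Lemma cell_ofE (M : seq cell) a : {subset M <= L} -> a \in M -> cell_of T M (T a) = a.
Proof.
move=> sub aM; have Ta : T a \in map T M by exact: map_f.
have im : (index (T a) (map T M) < size M)%N by rewrite -(size_map T) index_mem.
apply: tableau_inj; [exact/sub/mem_nth | exact: sub |].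
by rewrite -(nth_map _ 0%N) // nth_index.
Qed.

Lemma cell_ofP i : (0 < i <= k)%N -> c i \in L /\ T (c i) = i.
Proof.
move=> ik; have iT : i \in map T L by rewrite (perm_mem tableau_perm) mem_iota add1n ltnS.
by case/mapP: iT => a aL ->; rewrite cell_ofE.
Qed.

Lemma tableau_range a : a \in L -> (0 < T a <= k)%N.
Proof.
by move=> aL; have := perm_mem tableau_perm (T a); rewrite map_f // mem_iota add1n ltnS => <-.
Qed.

Lemma mem_tableau_cells m a : (m <= k)%N -> (a \in D m) = (a \in L) && (T a <= m)%N.
Proof.
move=> mk; apply/mapP/andP => [[i]|[aL Tm]].
  rewrite mem_rev mem_iota add1n ltnS => /andP[i0 im] ->.
  have ik : (0 < i <= k)%N by rewrite i0 (leq_trans im).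
  by have [-> ->] := cell_ofP ik.
exists (T a); last by rewrite cell_ofE.
by rewrite mem_rev mem_iota add1n ltnS Tm; case/andP: (tableau_range aL) => ->.
Qed.

Lemma cells_lower m n m' n' : (m, n) \in L -> (0 < m' <= m)%N -> (0 < n' <= n)%N ->
  (m', n') \in L.
Proof.
rewrite !mem_cells => /and4P[m0 ms n0 nl] /andP[m'0 mm] /andP[n'0 nn].
rewrite m'0 n'0 (leq_trans mm ms) /= (leq_trans nn) // (leq_trans nl) //.
have /andP[so _] := la_part; have [->//|ne] := eqVneq m' m.
have h := sorted_ltn_nth (fun b a d (ab : geq a b) (bd : geq b d) => leq_trans bd ab) 0%N so.
by apply: (h m'.-1 m.-1); rewrite ?inE; move: m0 ms mm m'0 ne; clear; lia.
Qed.

Lemma tableau_standard m : (m <= k)%N -> standard (D m).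
Proof.
elim: m => // m IHm mk; rewrite tableau_cellsS /= IHm ?(ltnW mk) //=.
have [cL Tc] := @cell_ofP m.+1 mk; case: T_std => _ Trow Tcol.
case: (c m.+1) cL Tc => i j cL Tc.
have /and4P[i0 _ j0 _] : [&& (0 < i)%N, (i <= size la)%N, (0 < j)%N & (j <= nth 0%N la i.-1)%N].
  by rewrite -mem_cells.
have mk' := ltnW mk.
apply/and5P; rewrite /= !mem_tableau_cells // cL Tc ltnn; split=> //.
- case: eqP => //= i1.
  have aL : (i.-1, j) \in L by apply: (cells_lower cL); move: i0 j0 i1; clear; lia.
  by rewrite aL -ltnS -Tc; apply: Tcol => //; move: i0; clear; lia.
case: eqP => //= j1.
have aL : (i, j.-1) \in L by apply: (cells_lower cL); move: i0 j0 j1; clear; lia.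
by rewrite aL -ltnS -Tc; apply: Trow => //; move: j0; clear; lia.
Qed.

Lemma cells_uniq : uniq L. Proof. exact: map_uniq tableau_uniq. Qed.

Lemma size_cells : size L = k.
Proof. by rewrite -(size_map T) (perm_size tableau_perm) size_iota. Qed.

Lemma tableau_cells_perm : perm_eq L (D k).
Proof.
apply: uniq_perm; [exact: cells_uniq | exact/standard_uniq/tableau_standard |].
move=> a; rewrite mem_tableau_cells //; case: (boolP (a \in L)) => //= aL.
by case/andP: (tableau_range aL) => _ ->.
Qed.

Lemma tableau_row_len m n : (m, n) \in L -> row_len L m = nth 0%N la m.-1.
Proof.
move=> h; have /and4P[m0 ms n0 nl] : [&& (0 < m)%N, (m <= size la)%N, (0 < n)%N & (n <= nth 0%N la m.-1)%N].
  by rewrite -mem_cells.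
rewrite /row_len (permP tableau_cells_perm) -/(row_len _ _).
have e j : (0 < j)%N -> (j <= row_len (D k) m)%N = (j <= nth 0%N la m.-1)%N.
  move=> j0; have := mem_row_len m j (tableau_standard (leqnn k)).
  by rewrite -(perm_mem tableau_cells_perm) mem_cells m0 ms j0 /= => ->.
apply/eqP; rewrite eqn_leq; apply/andP; split.
  by case: (posnP (row_len (D k) m)) => [->//|r0]; rewrite -e.
by rewrite e // (leq_trans n0).
Qed.

Lemma tableau_col_len m n : (m, n) \in L -> col_len L n = conj_part la n.
Proof.
move=> h; have /and4P[m0 ms n0 nl] : [&& (0 < m)%N, (m <= size la)%N, (0 < n)%N & (n <= nth 0%N la m.-1)%N].
  by rewrite -mem_cells.
have /andP[so _] := la_part.
rewrite /col_len (permP tableau_cells_perm) -/(col_len _ _).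
have e j : (0 < j)%N -> (j <= col_len (D k) n)%N = (j <= conj_part la n)%N.
  move=> j0; have := mem_col_len j n (tableau_standard (leqnn k)).
  rewrite -(perm_mem tableau_cells_perm) mem_cells n0 j0 /= => <-.
  rewrite -[in RHS](prednK j0) count_leq_sorted //.
  case: (leqP j (size la)) => // sj; rewrite nth_default ?leqn0; last by move: sj; clear; lia.
  by move: n0; clear; lia.
apply/eqP; rewrite eqn_leq; apply/andP; split.
  by case: (posnP (col_len (D k) n)) => [->//|r0]; rewrite -e.
by case: (posnP (conj_part la n)) => [->//|r0]; rewrite e.
Qed.

Lemma hook_lengthE a : a \in L -> hook_length (D k) a = hook la a.
Proof.
case: a => m n h; have /and4P[m0 ms n0 nl] : [&& (0 < m)%N, (m <= size la)%N, (0 < n)%N & (n <= nth 0%N la m.-1)%N].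
  by rewrite -mem_cells.
have e1 := tableau_row_len h; have e2 := tableau_col_len h.
have := h; rewrite (perm_mem tableau_cells_perm).
rewrite mem_col_len ?tableau_standard // => /and3P[_ _ mc].
move: mc; rewrite /hook_length /hook /= /row_len /col_len.
rewrite -!(permP tableau_cells_perm) -/(row_len L m) -/(col_len L n) e1 e2.
by move: nl; clear; lia.
Qed.

Lemma b_expE : b_exp la = (2 * \sum_(a <- L) a.2.-1)%N.
Proof.
rewrite /b_exp /cells big_allpairs_dep /= big_distrr /= (big_nth 0%N) big_mkord.
rewrite -[RHS](big_map predn xpredT (fun i => (2 * \sum_(n <- iota 1 (nth 0 la i)) n.-1)%N)).
have -> : [seq i.-1 | i <- iota 1 (size la)] = index_iota 0 (size la).
  by rewrite /index_iota subn0 -[1%N]/(1 + 0)%N iotaDl -map_comp map_id_in.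
rewrite [RHS]big_mkord; apply: eq_bigr => i _.
elim: (nth 0%N la i) => [|l IHl]; first by rewrite big_nil.
have -> : iota 1 l.+1 = iota 1 l ++ [:: l.+1] by rewrite -(addn1 l) iotaD addn1.
rewrite big_cat big_seq1 /= mulnDr -IHl.
by case: (l) => //= l'; rewrite !subn1 /=; lia.
Qed.

Lemma fusion_factorE (F : fieldType) (v t : F) :
  fusion_factor v t k la =
  t ^+ (k * (k - 1) %/ 2)%N * hook_product (v ^- 2) (D k).
Proof.
rewrite /fusion_factor /hook_product -(perm_big _ tableau_cells_perm) /=.
rewrite !big_split /= prodrXr big_const_seq count_predT size_cells iter_mulr mulr1.
rewrite b_expE exprM -exprVn -!mulrA [LHS]mulrCA; do 3!congr (_ * _).
apply: eq_big_seq => a aL; rewrite hook_lengthE //.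
by rewrite exprVn -exprM.
Qed.

Section Idempotent.
Variables (F : fieldType) (v t : F).

Lemma tableau_idempotentE m M : (m <= k)%N -> perm_eq M (D m) ->
  tableau_idempotent v t k T M m = chain_idempotent v (normalized_gen v t k) (D m).
Proof.
elim: m M => // -[|m] IHm M mk p.
  have -> : D 1 = [:: c 1%N] by [].
  rewrite [RHS]/= mul1r [other_contents _ _ _](_ : _ = [::]).
    by rewrite /root_prod !big_nil invr1 scale1r.
  have : standard (D 1) by exact: tableau_standard.
  move=> /= ac1; rewrite /other_contents (_ : [seq d <- _ | _] = [::]) //.
  have one d : can_add [::] d -> d = (1, 1)%N.
    case: d => i j /and5P[_ _ _ /= /orP[/eqP->|//] /orP[/eqP->|//]] //.
  apply/eqP; rewrite -[_ == _]negbK -has_filter; apply/hasPn => d.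
  by rewrite mem_addable // => /one ->; rewrite (one _ ac1) eqxx.
have MD z : z \in M = (z \in D m.+2) by exact: perm_mem.
have [cL Tc] := @cell_ofP m.+2 mk.
have cM : c m.+2 \in M by rewrite MD mem_tableau_cells // cL Tc leqnn.
have ec : cell_of T M m.+2 = c m.+2.
  rewrite -[in LHS]Tc cell_ofE // => z.
  by rewrite MD mem_tableau_cells // => /andP[].
have pr : perm_eq (rem (c m.+2) M) (D m.+1).
  rewrite -(perm_cons (c m.+2)) -tableau_cellsS -(permPr p) perm_sym.
  exact: perm_to_rem.
rewrite -[LHS]/(tableau_idempotent v t k T (rem (cell_of T M m.+2) M) m.+1 * _).
rewrite ec (IHm _ (ltnW mk) pr) (addable_cells_perm pr) (tableau_cellsS m.+1).
rewrite [RHS]/=; congr (_ * (_ *: _)).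
have szD : size (D m.+1) = m.+1 by rewrite size_map size_rev size_iota.
by rewrite szD jm_jucys_murphy.
Qed.

End Idempotent.
End Tableau.

(** * Genericity of the variable v *)

Lemma tofracX_neq0 (i : 'I_2) : tofrac ('X_i : {mpoly rat[2]}) != 0.
Proof. by rewrite tofrac_eq0 -['X_i]subr0 -mpolyC0 mpolyXsubC_neq0. Qed.

Lemma vQ_neq0 : vQ != 0. Proof. exact: tofracX_neq0. Qed.

Lemma tQ_neq0 : tQ != 0. Proof. exact: tofracX_neq0. Qed.

Lemma vQ_generic n : (0 < n)%N -> vQ ^+ n != 1.
Proof.
move=> n0; rewrite -rmorphXn -tofrac1 tofrac_eq; apply/eqP.
move=> /(congr1 (meval (fun=> 0))); rewrite rmorphXn rmorph1 /= mevalXU.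
by rewrite expr0n gtn_eqF // => /eqP; rewrite eq_sym oner_eq0.
Qed.

Theorem proposition6 (k : nat) (la : seq nat) (T : cell -> nat) :
  (0 < k)%N -> is_partition la -> sumn la = k -> standard_tableau k la T ->
  consecutive_evaluation
    (fun i => content vQ (cell_of T (cells la) i))
    (rf_scale (fusion_factor vQ tQ k la) (Psi vQ tQ k))
    (rf_cst k (tableau_idempotent vQ tQ k T (cells la) k)).
Proof.
move=> k0 la_part _ T_std.
rewrite (fusion_factorE la_part T_std).
rewrite (tableau_idempotentE la_part T_std vQ tQ (leqnn k) (tableau_cells_perm la_part T_std)).
apply: (fusion_consecutive vQ_neq0 tQ_neq0 vQ_generic k0).
- by [].
- by move=> m _; exact: tableau_cellsS.
exact: (tableau_standard la_part T_std).
Qed.
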